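(* Let $m\ge 0$ be an integer and let ${}^2\mathsf{G}_2(3^{2m+1})$ be the small Ree group, with its Sylow $3$-subgroups $U$ and $U^-=wUw^{-1}$. Then $${}^2\mathsf{G}_2\left(3^{2m+1}\right)=U\,U^-\,U\,U^-,$$ i.e. every element of ${}^2\mathsf{G}_2(3^{2m+1})$ is a product $u_1v_1u_2v_2$ with $u_1,u_2\in U$ and $v_1,v_2\in U^-$.
   Context: Let $F=\mathbb{F}_q$, $q=3^{2m+1}$, and $\theta=3^m$, so that $q=3\theta^2$. Rows and columns of $7\times7$ matrices are indexed, in this order, by $1,2,3,0,-3,-2,-1$; $e$ is the identity matrix and $e_{ij}$ (also written $e_{i,j}$) are the matrix units. Let $\alpha$ (short) and $\beta$ (long) be the simple roots of $\mathsf{G}_2$. For $\xi\in F$ the root elements are, for short roots, $x_{\alpha}(\xi)=e+\xi(e_{12}-e_{30}+2e_{0,-3}-e_{-2,-1})-\xi^2e_{3,-3}$, $x_{\alpha+\beta}(\xi)=e+\xi(e_{13}+e_{20}-2e_{0,-2}-e_{-3,-1})-\xi^2e_{2,-2}$, $x_{2\alpha+\beta}(\xi)=e+\xi(-e_{10}+e_{2,-3}-e_{3,-2}+2e_{0,-1})-\xi^2e_{1,-1}$, $x_{-\alpha}(\xi)=e+\xi(e_{21}-2e_{03}+e_{-3,0}-e_{-1,-2})-\xi^2e_{-3,3}$, $x_{-\alpha-\beta}(\xi)=e+\xi(e_{31}+2e_{02}-e_{-2,0}-e_{-1,-3})-\xi^2e_{-2,2}$, $x_{-2\alpha-\beta}(\xi)=e+\xi(-2e_{01}+e_{-3,2}-e_{-2,3}+e_{-1,0})-\xi^2e_{-1,1}$,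 and, for long roots, $x_{\beta}(\xi)=e+\xi(-e_{23}+e_{-3,-2})$, $x_{3\alpha+\beta}(\xi)=e+\xi(e_{1,-3}-e_{3,-1})$, $x_{3\alpha+2\beta}(\xi)=e+\xi(-e_{1,-2}+e_{2,-1})$, with $x_{-\gamma}(\xi)$ the transpose of $x_\gamma(\xi)$ for $\gamma\in\{\beta,3\alpha+\beta,3\alpha+2\beta\}$. The Chevalley group $G(\mathsf{G}_2,F)$ is the subgroup of $GL(7,F)$ generated by all these root elements. Let $\gamma\mapsto\overline{\gamma}$ be the permutation of the roots with $\alpha\leftrightarrow\beta$, $\alpha+\beta\leftrightarrow3\alpha+\beta$, $2\alpha+\beta\leftrightarrow3\alpha+2\beta$, and $\overline{-\gamma}=-\overline{\gamma}$. The exceptional automorphism $\sigma$ of $G(\mathsf{G}_2,F)$ is defined by $\sigma(x_\gamma(\xi))=x_{\overline{\gamma}}(\xi^{\lambda(\overline{\gamma})\theta})$ for all roots $\gamma$, where $\lambda(\gamma)=1$ if $\gamma$ is short and $\lambda(\gamma)=3$ if $\gamma$ is long. The small Ree group is ${}^2\mathsf{G}_2(3^{2m+1})=\{g\in G(\mathsf{G}_2,F)\mid\sigma(g)=g\}$. For $t,u,v\in F$ put $x_+(t,u,v)=x_1(t)x_2(u)x_3(v)$, where $x_1(t)=x_\alpha(t^\theta)\,x_\beta(t)\,x_{\alpha+\beta}(t^{\theta+1})\,x_{2\alpha+\beta}(t^{2\theta+1})$, $x_2(u)=x_{\alpha+\beta}(u^\theta)\,x_{3\alpha+\beta}(u)$,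 $x_3(v)=x_{2\alpha+\beta}(v^\theta)\,x_{3\alpha+2\beta}(v)$. Let $U=\{x_+(t,u,v)\mid t,u,v\in F\}$; this is the group of $\sigma$-fixed points of the subgroup generated by the positive root elements, and is a Sylow $3$-subgroup of ${}^2\mathsf{G}_2(3^{2m+1})$. Let $w$ be the $7\times7$ matrix with all entries $-1$ on the antidiagonal and $0$ elsewhere (so $w^2=e$ and $w\in{}^2\mathsf{G}_2(3^{2m+1})$), and let $U^-=wUw^{-1}$, again a Sylow $3$-subgroup. By Bruhat decomposition, with $h(\varepsilon)=\operatorname{diag}(\varepsilon,\varepsilon^{3\theta-1},\varepsilon^{2-3\theta},1,\varepsilon^{3\theta-2},\varepsilon^{1-3\theta},\varepsilon^{-1})$ for $\varepsilon\in F^*$, every element of ${}^2\mathsf{G}_2(3^{2m+1})$ can be written uniquely in exactly one of the forms $x_+(t_1,u_1,v_1)h(\varepsilon)w\,x_+(t_2,u_2,v_2)$ or $x_+(t,u,v)h(\varepsilon)$. *)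

(* Defs.v *)
From HB Require Import structures.
From mathcomp Require Import all_boot all_order all_algebra all_fingroup.
From mathcomp Require Import ring.

Set Implicit Arguments.
Unset Strict Implicit.
Unset Printing Implicit Defensive.

Import GRing.Theory.
Local Open Scope ring_scope.

Definition labels : seq int := [:: 1; 2; 3; 0; -3; -2; -1].

Definition pos (i : int) : 'I_7 := inZp (index i labels).
Arguments pos i%_Z.

Definition E (F : finFieldType) (i j : int) : 'M[F]_7 := delta_mx (pos i) (pos j).
Arguments E F (i j)%_Z.

(* The positive roots: [r_ab] is alpha + beta, [r_3a2b] is 3 alpha + 2 beta,
   and so on. *)
Inductive posroot := r_a | r_b | r_ab | r_2ab | r_3ab | r_3a2b.

Definition posroot_code (r : posroot) : 'I_6 :=
  match r with
  | r_a => inord 0 | r_b => inord 1 | r_ab => inord 2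
  | r_2ab => inord 3 | r_3ab => inord 4 | r_3a2b => inord 5
  end.

Definition posroot_decode (i : 'I_6) : posroot :=
  nth r_a [:: r_a; r_b; r_ab; r_2ab; r_3ab; r_3a2b] i.

Lemma posroot_codeK : cancel posroot_code posroot_decode.
Proof. by case; rewrite /posroot_decode /= inordK. Qed.

HB.instance Definition _ := Finite.copy posroot (can_type posroot_codeK).

(* [(r, false)] is the positive root r, [(r, true)] is the negative root -r. *)
Definition g2root : Type := (posroot * bool)%type.

Definition posbar (r : posroot) : posroot :=
  match r with
  | r_a => r_b | r_b => r_a
  | r_ab => r_3ab | r_3ab => r_ab
  | r_2ab => r_3a2b | r_3a2b => r_2ab
  end.

Definition bar (g : g2root) : g2root := (posbar g.1, g.2).

Definition lambda (g : g2root) : nat :=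
  match g.1 with
  | r_a | r_ab | r_2ab => 1
  | r_b | r_3ab | r_3a2b => 3
  end.

Section RootElements.
Variable F : finFieldType.
Local Notation e := (1%:M : 'M[F]_7).
Local Notation "''e_' ( i , j )" := (E F i j) (format "''e_' ( i ,  j )").

Definition x_mx (g : g2root) (xi : F) : 'M[F]_7 :=
  match g with
  | (r_a, false) =>
      e + xi *: ('e_(1, 2) - 'e_(3, 0) + 2 *: 'e_(0, -3) - 'e_(-2, -1))
        - xi ^+ 2 *: 'e_(3, -3)
  | (r_ab, false) =>
      e + xi *: ('e_(1, 3) + 'e_(2, 0) - 2 *: 'e_(0, -2) - 'e_(-3, -1))
        - xi ^+ 2 *: 'e_(2, -2)
  | (r_2ab, false) =>
      e + xi *: (- 'e_(1, 0) + 'e_(2, -3) - 'e_(3, -2) + 2 *: 'e_(0, -1))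
        - xi ^+ 2 *: 'e_(1, -1)
  | (r_a, true) =>
      e + xi *: ('e_(2, 1) - 2 *: 'e_(0, 3) + 'e_(-3, 0) - 'e_(-1, -2))
        - xi ^+ 2 *: 'e_(-3, 3)
  | (r_ab, true) =>
      e + xi *: ('e_(3, 1) + 2 *: 'e_(0, 2) - 'e_(-2, 0) - 'e_(-1, -3))
        - xi ^+ 2 *: 'e_(-2, 2)
  | (r_2ab, true) =>
      e + xi *: (- (2 *: 'e_(0, 1)) + 'e_(-3, 2) - 'e_(-2, 3) + 'e_(-1, 0))
        - xi ^+ 2 *: 'e_(-1, 1)
  | (r_b, false) => e + xi *: (- 'e_(2, 3) + 'e_(-3, -2))
  | (r_3ab, false) => e + xi *: ('e_(1, -3) - 'e_(3, -1))
  | (r_3a2b, false) => e + xi *: (- 'e_(1, -2) + 'e_(2, -1))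
  | (r_b, true) => (e + xi *: (- 'e_(2, 3) + 'e_(-3, -2)))^T
  | (r_3ab, true) => (e + xi *: ('e_(1, -3) - 'e_(3, -1)))^T
  | (r_3a2b, true) => (e + xi *: (- 'e_(1, -2) + 'e_(2, -1)))^T
  end.

Lemma mulE i j k l : 'e_(i, j) *m 'e_(k, l) = 'e_(i, l) *+ (pos j == pos k).
Proof. exact: mul_delta_mx_cond. Qed.

Lemma exp2_mxN (A B : 'M[F]_7) (xi : F) :
    A *m A = - (B + B) -> A *m B = 0 -> B *m A = 0 -> B *m B = 0 ->
  (e + xi *: A - xi ^+ 2 *: B) *m (e + - xi *: A - (- xi) ^+ 2 *: B) = e.
Proof.
move=> AA AB BA BB.
rewrite !(mulmxDl, mulmxDr, mulNmx, mulmxN, mul1mx, mulmx1).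
rewrite -!scalemxAl -!scalemxAr AA AB BA BB !(scaler0, oppr0, addr0).
by apply/matrixP=> i j; rewrite !mxE; ring.
Qed.

Lemma exp1_mxN (A : 'M[F]_7) (xi : F) :
  A *m A = 0 -> (e + xi *: A) *m (e + - xi *: A) = e.
Proof.
move=> AA; rewrite mulmxDl !mulmxDr !mul1mx mulmx1.
by rewrite -scalemxAl -scalemxAr AA !scaler0 addr0 scaleNr addrNK.
Qed.

Lemma exp1N_mx (A : 'M[F]_7) (xi : F) :
  A *m A = 0 -> (e + - xi *: A) *m (e + xi *: A) = e.
Proof. by move=> AA; rewrite -{2}[xi]opprK exp1_mxN. Qed.

Lemma x_mxN g xi : x_mx g xi *m x_mx g (- xi) = 1%:M.
Proof.
have S := (mulmxDl, mulmxDr, mulNmx, mulmxN, mulE, =^~ scalemxAl, =^~ scalemxAr).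
have S0 := (mulr0n, mulr1n, scaler0, oppr0, addr0, add0r).
case: g => [[] []] /=; rewrite -?trmx_mul.
1-2,5-8: apply: exp2_mxN; rewrite !S /= !S0 //.
1-6: by rewrite scaler_nat mulr2n.
all: by rewrite ?exp1_mxN ?exp1N_mx ?trmx1 // !S /= !S0.
Qed.

Lemma x_mx_unit g xi : x_mx g xi \is a GRing.unit.
Proof. by case/mulmx1_unit: (x_mxN g xi). Qed.

Definition x (g : g2root) (xi : F) : {'GL_7[F]} :=
  FinRing.unit _ (x_mx_unit g xi).

Definition w_mx : 'M[F]_7 := \matrix_(i, j) (if (i + j == 6)%N then -1 else 0).

Lemma w_mxK : w_mx *m w_mx = 1%:M.
Proof.
apply/matrixP => i j; rewrite mxE !big_ord_recl big_ord0;
case: i => [[|[|[|[|[|[|[|i]]]]]]] hi] //; case: j => [[|[|[|[|[|[|[|j]]]]]]] hj] //;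
rewrite !mxE /=; ring.
Qed.

Lemma w_mx_unit : w_mx \is a GRing.unit.
Proof. by case/mulmx1_unit: w_mxK. Qed.

Definition w : {'GL_7[F]} := FinRing.unit _ w_mx_unit.

End RootElements.

Section ReeGroup.
Variables (F : finFieldType) (m : nat).
Local Open Scope group_scope.

Definition chevalley_G2 : {group {'GL_7[F]}} :=
  <<[set x g xi | g : g2root, xi : F]>>%G.

Definition theta : nat := (3 ^ m)%N.

(* In MathComp [Aut G] is the group of permutations of the ambient type that
   restrict to an automorphism of G and fix every element outside G.  The
   condition on root elements determines sigma, as they generate G. *)
Definition exceptional_automorphism (sigma : {perm {'GL_7[F]}}) : Prop :=
  sigma \in Aut chevalley_G2 /\
  (forall (g : g2root) (xi : F),
     sigma (x g xi) = x (bar g) (xi ^+ (lambda (bar g) * theta))%R).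

Definition small_ree (sigma : {perm {'GL_7[F]}}) : {set {'GL_7[F]}} :=
  [set g in chevalley_G2 | sigma g == g].

Definition x1 (t : F) : {'GL_7[F]} :=
  x (r_a, false) (t ^+ theta)%R * x (r_b, false) t *
  x (r_ab, false) (t ^+ (theta + 1))%R * x (r_2ab, false) (t ^+ (2 * theta + 1))%R.

Definition x2 (u : F) : {'GL_7[F]} :=
  x (r_ab, false) (u ^+ theta)%R * x (r_3ab, false) u.

Definition x3 (v : F) : {'GL_7[F]} :=
  x (r_2ab, false) (v ^+ theta)%R * x (r_3a2b, false) v.

Definition x_plus (t u v : F) : {'GL_7[F]} := x1 t * x2 u * x3 v.

Definition U : {set {'GL_7[F]}} :=
  [set x_plus p.1.1 p.1.2 p.2 | p : F * F * F].

Definition U_minus : {set {'GL_7[F]}} := [set w F * g * (w F)^-1 | g in U].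

End ReeGroup.

(* Main.v *)
From Stdlib Require Import ZArith Ring_polynom InitialRing.
Require Import Defs.
From HB Require Import structures.
From mathcomp Require Import all_boot all_order all_algebra all_fingroup.
From mathcomp Require Import finfield.
From mathcomp Require Import ring zify.

(** Write G for the Ree group, e_i for the unit column vectors, V for the
    natural module.  Two facts about the action of G on V give the theorem.

    Bruhat decomposition.  If g is in G and the (-1,1) entry of g is 0, then
    g e_1 is a multiple of e_1; otherwise some x in U makes x^-1 g e_1 a
    multiple of e_(-1), and w exchanges the lines of e_1 and e_(-1)
    ([corner0], [cornerN0]).  Moreover an element of G that fixes e_1 lies in U
    ([mem_U]).  Hence an element that multiplies e_1 by c is determined by c up
    to U, and no torus has to be constructed: it is enough to exhibit, for
    every nonzero c, one element of G that scales e_1 by c.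

    Corners.  The elements w y w with y in U supply these scalars.  If c is the
    (1,-1) entry of y, then w y w is in U w b with b scaling e_1 by -c, so that
    b is in wUwUw.  That entry takes every nonzero value: on x_1(t) it is a
    square, on x_3(v) it is minus a square, all squares and all their negatives
    are reached, and these are all elements since q is 3 modulo 4
    ([corner_onto]).  The purely group-theoretic [four_factors] combines such
    elements into G = UwUwUwUw, which is U U^- U U^- because w w = 1.

    The Bruhat decomposition is proved without that of the group of type G2.
    In characteristic 3 the exterior square of V has a 14-dimensional submodule
    W = { bivector s t } with a submodule { bivector 0 t } isomorphic to V, and
    the quotient has the long roots and 0 as its weights.  A Frobenius twist of
    this quotient is V with the action of sigma: for g in the group of type G2,
      g (bivector s t) g^T = bivector (rho(g) s) t'   for some t',
    where the entries of rho(g) are the (3 theta)-th powers of those of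
    sigma(g) ([G2_sigma]).  Checking this on the twelve families of root
    elements is a computation with polynomials over the integers modulo 3.
    For g in G, so that sigma(g) = g, it expresses the (3 theta)-th powers of the
    entries of g by its 2 x 2 minors.
    Applied to the first two columns p, q of g, it says that the point of p and
    the line of p and q form a flag fixed by the polarity of the generalised
    hexagon, and the resulting equations, together with the invariant quadratic
    form, have only the solutions claimed above ([flag_in_hyperplane],
    [flag_opposite]).  Applied to further pairs of columns, it shows that an
    element fixing e_1 whose entries (1,2), (1,3) and (1,0) vanish is 1
    ([ree_unipotent]). *)

Set Implicit Arguments.
Unset Strict Implicit.
Unset Printing Implicit Defensive.

Import GRing.Theory.
Local Open Scope ring_scope.

(** * Matrix identities in characteristic 3, by computation *)

(** Matrices with polynomial entries are lists of rows of ring expressions.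
    Products are computed in the Horner normal form of the ring tactic, with
    coefficients compared modulo 3, so that an identity between products of
    such matrices becomes a boolean computation. *)
Notation pterm := (PExpr Z).
Declare Scope poly_scope.
Delimit Scope poly_scope with P.
Bind Scope poly_scope with PExpr.
Notation "0" := (@PEO Z) : poly_scope.
Notation "1" := (@PEI Z) : poly_scope.
Notation "a + b" := (@PEadd Z a b) : poly_scope.
Notation "a - b" := (@PEsub Z a b) : poly_scope.
Notation "a * b" := (@PEmul Z a b) : poly_scope.
Notation "- a" := (@PEopp Z a) : poly_scope.
Notation var i := (@PEX Z i).

(** Rather than normalising coefficients modulo 3, it suffices that the zero
    test of the normal forms is the one modulo 3. *)
Definition eqb3 (a b : Z) : bool := Z.eqb (Z.modulo (Z.sub a b) (Zpos 3)) Z0.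

Definition nf : pterm -> Pol Z := norm_aux Z0 Z.one Z.add Z.mul Z.sub Z.opp eqb3.
Definition nf_add : Pol Z -> Pol Z -> Pol Z := Padd Z0 Z.add eqb3.
Definition nf_mul : Pol Z -> Pol Z -> Pol Z := Pmul Z0 Z.one Z.add Z.mul eqb3.

Definition grid T (f : nat -> nat -> T) : seq (seq T) :=
  [seq [seq f i j | j <- iota 0 7] | i <- iota 0 7].

Definition entry T (z : T) (A : seq (seq T)) (i j : nat) : T := nth z (nth [::] A i) j.

Definition nf_mulmx (A B : seq (seq (Pol Z))) : seq (seq (Pol Z)) :=
  let term i j k := nf_mul (entry (P0 Z0) A i k) (entry (P0 Z0) B k j) in
  grid (fun i j => foldr (fun k => nf_add (term i j k)) (P0 Z0) (iota 0 7)).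

Definition nf_prod (As : seq (seq (seq pterm))) : seq (seq (Pol Z)) :=
  foldr (fun A => nf_mulmx (map (map nf) A))
        (grid (fun i j => if i == j then P1 Z.one else P0 Z0)) As.

(** Both sides are lists of factors, so that no product has to be expanded by
    hand. *)
Definition check_prod (As Bs : seq (seq (seq pterm))) : bool :=
  all (fun i => all (fun j => Peq eqb3 (entry (P0 Z0) (nf_prod As) i j)
                                       (entry (P0 Z0) (nf_prod Bs) i j))
                    (iota 0 7)) (iota 0 7).

Section Evaluation.
Variable F : finFieldType.
Hypothesis three0 : 3%:R = 0 :> F.

Notation phi := (gen_phiZ (0 : F) 1 +%R *%R -%R).

Definition eval (l : seq F) : pterm -> F :=
  PEeval 0 1 +%R *%R (fun x y => x - y) -%R phi id_phi_N (pow_N 1 *%R) l.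

Definition eval_mx (l : seq F) (A : seq (seq pterm)) : 'M[F]_7 :=
  \matrix_(i, j) eval l (entry PEO A i j).

Let ringF : ring_theory (0 : F) 1 +%R *%R (fun x y => x - y) -%R eq.
Proof.
split=> //; [exact: add0r|exact: addrC|exact: addrA|exact: mul1r|exact: mulrC
  |exact: mulrA|exact: mulrDl|exact: subrr].
Qed.

Let extF := Eq_ext (+%R : F -> F -> F) *%R -%R.

Let morphF : ring_morph (0 : F) 1 +%R *%R (fun x y => x - y) -%R eq
  Z0 Z.one Z.add Z.mul Z.sub Z.opp eqb3 phi.
Proof.
have [M0 M1 MD MB MM MN _] := gen_phiZ_morph (Eqsth F) extF ringF.
split=> // a b /Z.eqb_eq ab3.
apply/eqP; rewrite -subr_eq0 -MB; apply/eqP.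
have -> : Z.sub a b = Z.mul (Z.add Z.one (Z.add Z.one Z.one)) (Z.div (Z.sub a b) (Zpos 3)).
  by rewrite {1}(Z.div_mod (Z.sub a b) (Zpos 3)) // ab3 Z.add_0_r.
by rewrite MM !MD M1 -mulr2n -mulrS three0 mul0r.
Qed.

Let almostF := Rth_ARth (Eqsth F) extF ringF.
Let powF := pow_N_th (1 : F) *%R (Eqsth F).

Notation eval_nf l := (Pphi (0 : F) +%R *%R phi l).
Definition eval_nfmx (l : seq F) (A : seq (seq (Pol Z))) : 'M[F]_7 :=
  \matrix_(i, j) eval_nf l (entry (P0 Z0) A i j).

Lemma eval_nfE l a : eval_nf l (nf a) = eval l a.
Proof. exact: esym (norm_aux_spec (Eqsth F) extF almostF morphF powF l a). Qed.

Lemma eval_nf_add l P Q : eval_nf l (nf_add P Q) = eval_nf l P + eval_nf l Q.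
Proof. exact: (Padd_ok (Eqsth F) extF almostF morphF). Qed.

Lemma eval_nf_mul l P Q : eval_nf l (nf_mul P Q) = eval_nf l P * eval_nf l Q.
Proof. exact: (Pmul_ok (Eqsth F) extF almostF morphF). Qed.

Lemma entry_grid T (z : T) f (i j : 'I_7) : entry z (grid f) i j = f i j.
Proof.
by rewrite /entry /grid !(nth_map 0%N) ?size_iota // !nth_iota.
Qed.

Lemma entry_map T S (f : T -> S) z A i j :
  entry (f z) (map (map f) A) i j = f (entry z A i j).
Proof.
rewrite /entry; case: (ltnP i (size A)) => iA; last first.
  by rewrite !(nth_default [::]) ?size_map // !nth_nil.
rewrite (nth_map [::]) //; move: (nth [::] A i) => r.
by case: (ltnP j (size r)) => jr; [rewrite (nth_map z)|rewrite !nth_default ?size_map].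
Qed.

Lemma eval_nfmx_mul l A B : eval_nfmx l (nf_mulmx A B) = eval_nfmx l A *m eval_nfmx l B.
Proof.
pose f i j k := eval_nf l (entry (P0 Z0) A i k) * eval_nf l (entry (P0 Z0) B k j).
apply/matrixP=> i j; rewrite !mxE entry_grid.
rewrite [RHS](eq_bigr (fun k : 'I_7 => f i j k)) => [|k _]; last by rewrite !mxE.
rewrite -(big_mkord xpredT (f i j)) /index_iota subn0 unlock.
elim: (iota 0 7) => //= k s IHs.
by rewrite eval_nf_add eval_nf_mul IHs.
Qed.

Lemma eval_nf_prod l As :
  eval_nfmx l (nf_prod As) = foldr (fun A M => eval_mx l A *m M) 1%:M As.
Proof.
elim: As => [|A As IHA] /=.
  by apply/matrixP=> i j; rewrite !mxE entry_grid -val_eqE; case: eqP.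
rewrite eval_nfmx_mul IHA; congr (_ *m _).
by apply/matrixP=> i j; rewrite !mxE (entry_map nf 0%P) eval_nfE.
Qed.

(** Characteristic 3 enters through the zero test of the normal forms. *)
Lemma check_prodP l As Bs : check_prod As Bs ->
  foldr (fun A M => eval_mx l A *m M) 1%:M As =
  foldr (fun A M => eval_mx l A *m M) 1%:M Bs.
Proof.
have mem7 (k : 'I_7) : (k : nat) \in iota 0 7 by rewrite mem_iota ltn_ord.
rewrite -!eval_nf_prod => /allP chk; apply/matrixP=> i j; rewrite !mxE.
exact: (Peq_ok (Eqsth F) extF morphF _ _ (allP (chk i (mem7 i)) j (mem7 j))).
Qed.

End Evaluation.

(** * The root elements as matrices of polynomials *)

Definition sparse (s : seq (int * int * pterm)%type) (i j : nat) : pterm :=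
  foldr (fun x t =>
           if (i == pos x.1.1 :> nat) && (j == pos x.1.2 :> nat) then x.2 else t)
        (if i == j then 1%P else 0%P) s.

Definition root_entries (r : posroot) (neg : bool) (a : pterm) :
    seq (int * int * pterm)%type :=
  match r, neg with
  | r_a, false =>
      [:: (1, 2, a); (3, 0, - a); (0, -3, a + a); (-2, -1, - a); (3, -3, - (a * a))]
  | r_ab, false =>
      [:: (1, 3, a); (2, 0, a); (0, -2, - (a + a)); (-3, -1, - a); (2, -2, - (a * a))]
  | r_2ab, false =>
      [:: (1, 0, - a); (2, -3, a); (3, -2, - a); (0, -1, a + a); (1, -1, - (a * a))]
  | r_a, true =>
      [:: (2, 1, a); (0, 3, - (a + a)); (-3, 0, a); (-1, -2, - a); (-3, 3, - (a * a))]
  | r_ab, true =>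
      [:: (3, 1, a); (0, 2, a + a); (-2, 0, - a); (-1, -3, - a); (-2, 2, - (a * a))]
  | r_2ab, true =>
      [:: (0, 1, - (a + a)); (-3, 2, a); (-2, 3, - a); (-1, 0, a); (-1, 1, - (a * a))]
  | r_b, false => [:: (2, 3, - a); (-3, -2, a)]
  | r_3ab, false => [:: (1, -3, a); (3, -1, - a)]
  | r_3a2b, false => [:: (1, -2, - a); (2, -1, a)]
  | r_b, true => [:: (3, 2, - a); (-2, -3, a)]
  | r_3ab, true => [:: (-3, 1, a); (-1, 3, - a)]
  | r_3a2b, true => [:: (-2, 1, - a); (-1, 2, a)]
  end%Z%P.

Definition root_term (g : g2root) (a : pterm) : seq (seq pterm) :=
  grid (sparse (root_entries g.1 g.2 a)).

Lemma posE :
  ((nat_of_ord (pos 1) = 0%N) * (nat_of_ord (pos 2) = 1%N) * (nat_of_ord (pos 3) = 2%N)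
  * (nat_of_ord (pos 0) = 3%N) * (nat_of_ord (pos (-3)) = 4%N)
  * (nat_of_ord (pos (-2)) = 5%N) * (nat_of_ord (pos (-1)) = 6%N))%type.
Proof. by []. Qed.

Lemma E_entry (F : finFieldType) a b (i j : 'I_7) :
  E F a b i j = ((i == pos a :> nat) && (j == pos b :> nat))%:R.
Proof. by rewrite mxE. Qed.

Lemma x_mxE (F : finFieldType) (l : seq F) g a :
  x_mx g (eval l a) = eval_mx l (root_term g a).
Proof.
case: g => [[] []]; apply/matrixP=> i j; rewrite [RHS]mxE entry_grid /sparse /=;
rewrite !(E_entry, mxE) !posE /=.
all: case: i j => [[|[|[|[|[|[|[|i]]]]]]] hi] // [[|[|[|[|[|[|[|j]]]]]]] hj] //=.
all: ring.
Qed.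

(** * The invariant forms of the group of type G2 *)

Section Forms.
Variable F : finFieldType.
Local Notation "''e_' ( i , j )" := (E F i j) (format "''e_' ( i ,  j )").
Local Notation "v '_[' i ]" := (v (pos i) (0 : 'I_1)) (at level 2, format "v '_[' i ]").

Definition quadric : 'M[F]_7 :=
  'e_(1, -1) + 'e_(2, -2) + 'e_(3, -3) - 'e_(0, 0)
  + 'e_(-3, 3) + 'e_(-2, 2) + 'e_(-1, 1).

(** The antisymmetrisation of [short_part t] is, up to a scalar, the only
    equivariant embedding of the natural module into its exterior square; each
    coefficient is thus forced by the root elements. *)
Definition short_part (t : 'cV[F]_7) : 'M[F]_7 :=
  t _[1] *: ('e_(1, 0) + 'e_(2, 3)) + t _[2] *: ('e_(1, -3) - 'e_(2, 0))
  - t _[3] *: ('e_(1, -2) + 'e_(3, 0))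
  + t _[0] *: ('e_(1, -1) - 'e_(2, -2) - 'e_(3, -3))
  - t _[-3] *: ('e_(2, -1) + 'e_(0, -3)) + t _[-2] *: ('e_(3, -1) - 'e_(0, -2))
  + t _[-1] *: ('e_(0, -1) + 'e_(-3, -2)).

(** Long-root vectors of the exterior square and one vector of weight 0, chosen
    modulo the short part.  The vector multiplied by [s _[i]] has the weight
    that [posbar] exchanges with the weight of the i-th coordinate: for i = 1
    these are 3 alpha + 2 beta and 2 alpha + beta. *)
Definition long_part (s : 'cV[F]_7) : 'M[F]_7 :=
  s _[1] *: 'e_(1, 2) - s _[2] *: 'e_(1, 3) - s _[3] *: 'e_(2, -3)
  + s _[0] *: ('e_(1, -1) + 'e_(2, -2))
  - s _[-3] *: 'e_(3, -2) - s _[-2] *: 'e_(-3, -1) + s _[-1] *: 'e_(-2, -1).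

Definition bivector (s t : 'cV[F]_7) : 'M[F]_7 :=
  (long_part s + short_part t) - (long_part s + short_part t)^T.

Definition quadric_term : seq (seq pterm) :=
  grid (fun i j => if (i + j == 6)%N then (if i == 3%N then PEopp 1 else 1%P)%P else 0%P).

Definition bivector_term (s t : seq pterm) : seq (seq pterm) :=
  let S i := nth 0%P s (pos i) in let T i := nth 0%P t (pos i) in
  let up := [:: (1, 2, S 1); (1, 3, - S 2); (1, 0, T 1); (1, -3, T 2); (1, -2, - T 3);
    (1, -1, S 0 + T 0); (2, 3, T 1); (2, 0, - T 2); (2, -3, - S 3); (2, -2, S 0 + - T 0);
    (2, -1, - T (-3)); (3, 0, - T 3); (3, -3, - T 0); (3, -2, - S (-3)); (3, -1, T (-2));
    (0, -3, - T (-3)); (0, -2, - T (-2)); (0, -1, T (-1)); (-3, -2, T (-1));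
    (-3, -1, - S (-2)); (-2, -1, S (-1))]%Z%P in
  let at_entry i j (x : (int * int * pterm)%type) :=
    (i == pos x.1.1 :> nat) && (j == pos x.1.2 :> nat) in
  grid (fun i j => foldr (fun x a => if at_entry i j x then x.2 else
                                     if at_entry j i x then PEopp x.2 else a) 0%P up).

Definition eval_cv (l : seq F) (v : seq pterm) : 'cV[F]_7 := \col_i eval l (nth 0%P v i).

Lemma bivectorE l s t : bivector (eval_cv l s) (eval_cv l t) = eval_mx l (bivector_term s t).
Proof.
apply/matrixP=> i j; rewrite [RHS]mxE entry_grid /=.
rewrite !(E_entry, mxE) !posE /=.
case: i j => [[|[|[|[|[|[|[|i]]]]]]] hi] // [[|[|[|[|[|[|[|j]]]]]]] hj] //=.
all: ring.
Qed.

Lemma quadricE l : quadric = eval_mx l quadric_term.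
Proof.
apply/matrixP=> i j; rewrite [RHS]mxE entry_grid /=.
rewrite !(E_entry, mxE) !posE /=.
case: i j => [[|[|[|[|[|[|[|i]]]]]]] hi] // [[|[|[|[|[|[|[|j]]]]]]] hj] //=.
all: ring.
Qed.

Definition tr_term (A : seq (seq pterm)) := grid (fun i j => entry 0%P A j i).

Lemma tr_termE (l : seq F) A : (eval_mx l A)^T = eval_mx l (tr_term A).
Proof. by apply/matrixP=> i j; rewrite !mxE entry_grid. Qed.

(** A product that is not normalised; it only serves to write down the unknown t'
    of [root_bivector] as a polynomial. *)
Definition mul_term (A B : seq (seq pterm)) :=
  grid (fun i j => foldr (fun k a => (entry 0%P A i k * entry 0%P B k j + a)%P) 0%P (iota 0 7)).
Definition app_term (A : seq (seq pterm)) (v : seq pterm) :=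
  [seq foldr (fun k a => (entry 0%P A i k * nth 0%P v k + a)%P) 0%P (iota 0 7) | i <- iota 0 7].

Lemma sum7_term (l : seq F) (f : nat -> pterm) :
  eval l (foldr (fun k a => (f k + a)%P) 0%P (iota 0 7)) = \sum_(k < 7) eval l (f k).
Proof.
rewrite -(big_mkord xpredT (fun k => eval l (f k))) /index_iota subn0 unlock.
by elim: (iota 0 7) => //= k s ->.
Qed.

Lemma app_termE (l : seq F) A v : eval_mx l A *m eval_cv l v = eval_cv l (app_term A v).
Proof.
apply/matrixP=> i j; rewrite !mxE /app_term (nth_map 0%N) ?size_iota // nth_iota //.
by rewrite sum7_term; apply: eq_bigr => k _; rewrite !mxE.
Qed.

(** For every weight of the short part, an entry of [bivector s t] to which [s]
    does not contribute; for the weight 0 it is the entry (3,-3). *)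
Definition short_coords (A : seq (seq pterm)) : seq pterm :=
  let a i j := entry 0%P A (pos i) (pos j) in
  [:: a 1 0; a 1 (-3); - a 3 0; - a 3 (-3); - a 2 (-1); a 3 (-1); a 0 (-1)]%Z%P.

(** An arbitrary column vector is the value of a column of variables. *)
Definition vars (k : nat) : seq pterm := [seq var (Pos.of_nat i) | i <- iota k.+1 7].

Definition coords (v : 'cV[F]_7) : seq F := [seq v (inord k) 0 | k <- iota 0 7].

Lemma vars_eval (x : F) (s t : 'cV[F]_7) (l := x :: coords s ++ coords t) :
  [/\ x = eval l (var 1), s = eval_cv l (vars 1) & t = eval_cv l (vars 8)].
Proof.
by split=> //; apply/matrixP=> i j; rewrite ord1 mxE -{1}(inord_val i);
case: i => [[|[|[|[|[|[|[|i]]]]]]] hi].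
Qed.

Hypothesis three0 : 3%:R = 0 :> F.

Lemma root_quadric g xi : (x_mx g xi)^T *m quadric *m x_mx g xi = quadric.
Proof.
pose l := [:: xi]; have -> : xi = eval l (var 1) by [].
rewrite x_mxE tr_termE (quadricE l) -mulmxA.
have chk : check_prod
    [:: tr_term (root_term g (var 1)); quadric_term; root_term g (var 1)] [:: quadric_term].
  by move: g; do 3!case; vm_compute.
by have := check_prodP three0 l chk; rewrite /= !mulmx1.
Qed.

Definition lam_term (g : g2root) (a : pterm) :=
  if lambda g == 1%N then a else (a * (a * a))%P.

Lemma lam_termE (l : seq F) g a : eval l (lam_term g a) = eval l a ^+ lambda g.
Proof. by case: g => [[] b]. Qed.

(** In characteristic 3 the 14-dimensional submodule of the exterior square
    modulo its short part is the natural module twisted by the special isogeny,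
    which exchanges long and short root subgroups: this is where [bar] and
    [lambda] come from.  The witness is linear in s and t, and is read off from
    the image by [short_coords]. *)
Lemma root_bivector g xi s t : exists t',
  x_mx g xi *m bivector s t *m (x_mx g xi)^T =
  bivector (x_mx (bar g) (xi ^+ lambda (bar g)) *m s) t'.
Proof.
have [] := vars_eval xi s t; set l := _ :: _ => -> -> ->.
rewrite -lam_termE !x_mxE bivectorE tr_termE app_termE.
pose G := root_term g (var 1); pose A := bivector_term (vars 1) (vars 8).
pose R := root_term (bar g) (lam_term (bar g) (var 1)).
pose B := short_coords (mul_term G (mul_term A (tr_term G))).
exists (eval_cv l B); rewrite bivectorE -mulmxA.
have chk : check_prod [:: G; A; tr_term G] [:: bivector_term (app_term R (vars 1)) B].
  by rewrite {}/B {}/A {}/R {}/G; move: g; do 3!case; vm_compute.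
by have := check_prodP three0 l chk; rewrite /= !mulmx1.
Qed.

Lemma root_short g xi t :
  x_mx g xi *m bivector 0 t *m (x_mx g xi)^T = bivector 0 (x_mx g xi *m t).
Proof.
have [] := vars_eval xi 0 t; set l := _ :: _ => -> _ ->.
have -> : 0 = eval_cv l [::] by apply/matrixP=> i j; rewrite !mxE nth_nil.
rewrite x_mxE bivectorE tr_termE app_termE bivectorE -mulmxA.
set G := root_term g _; set A := bivector_term _ _; set B := bivector_term _ _.
have chk : check_prod [:: G; A; tr_term G] [:: B].
  by rewrite {}/B {}/A {}/G; move: g; do 3!case; vm_compute.
by have := check_prodP three0 l chk; rewrite /= !mulmx1.
Qed.

End Forms.

(** * The exceptional automorphism and its fixed points *)

(** The characteristic is an argument, so that the power map is a ring morphism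
    by its type alone. *)
Definition frob (F : finFieldType) (ch : 3 \in [pchar F]) (k : nat) (x : F) : F := x ^+ (3 ^ k).

Section Frob.
Variables (F : finFieldType) (ch : 3 \in [pchar F]) (k : nat).

Fact frob_zmod : zmod_morphism (frob ch k).
Proof.
have n3 : [pchar F].-nat (3 ^ k)%N by rewrite pnatX pnatE // ch.
by move=> a b; apply: (canRL (addrK _)); rewrite /frob -exprDn_pchar // subrK.
Qed.

Fact frob_monoid : monoid_morphism (frob ch k).
Proof. by split=> [|a b]; rewrite /frob ?expr1n ?exprMn. Qed.

HB.instance Definition _ := GRing.isZmodMorphism.Build F F (frob ch k) frob_zmod.
HB.instance Definition _ := GRing.isMonoidMorphism.Build F F (frob ch k) frob_monoid.

Lemma map_x_mx g xi : map_mx (frob ch k) (x_mx g xi) = x_mx g (frob ch k xi).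
Proof.
have S := (map_mxD, map_mxB, map_mxN, map_mxZ, map_delta_mx, map_mx1, rmorphXn, rmorph_nat).
by case: g => [[] []] /=; rewrite /E -?map_trmx !S.
Qed.

End Frob.

(** For a and b representing the simple reflections in type G2, c represents
    the longest element, whose two reduced words are exchanged by s. *)
Lemma fixed_braid (gT : finGroupType) (G : {group gT}) (s : gT -> gT) (a b c : gT) :
    {in G &, {morph s : x y / (x * y)%g}} -> a \in G -> b \in G -> s a = b -> s b = a ->
    c = (a * b * (a * b) * (a * b))%g -> c = (b * a * (b * a) * (b * a))%g ->
  c \in G /\ s c = c.
Proof.
move=> sM Ga Gb sa sb cE c'E; rewrite {1}cE !groupM //; split=> //.
by rewrite {1}cE !sM ?groupM // sa sb -c'E.
Qed.

Section Group.
Variables (m : nat) (F : finFieldType).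
Hypothesis cardF : #|F| = (3 ^ (2 * m + 1))%N.

Fact char3 : 3 \in [pchar F].
Proof. exact: card_finPcharP cardF _. Qed.

Let three0 : 3%:R = 0 :> F.
Proof. by rewrite pcharf0 ?char3. Qed.

Local Notation phi := (frob char3 m.+1).

(** As q = 3 theta^2, the (3 theta)-th power map inverts the theta-th one. *)
Lemma thetaK a : phi (a ^+ theta m) = a.
Proof.
have two_m1 : (m + m.+1 = 2 * m + 1)%N by rewrite addnS addnn mul2n addn1.
by rewrite /frob -exprM /theta -expnD two_m1 -cardF expf_card.
Qed.

Lemma phiK a : (phi a) ^+ theta m = a.
Proof. by rewrite -[RHS]thetaK /frob exprAC. Qed.

(** Inverses do not occur because the group is finite. *)
Lemma generated_ind (gT : finGroupType) (A : {set gT}) (P : gT -> Prop) :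
  P 1%g -> (forall a b, P a -> P b -> P (a * b)%g) -> {in A, forall a, P a} ->
  {in <<A>>%g, forall g, P g}.
Proof.
move=> P1 PM PA g /gen_prodgP[n [c cA ->]].
by apply: big_ind => // i _; apply: PA.
Qed.

Lemma val_mul (a b : {'GL_7[F]}) : val (a * b)%g = val a *m val b.
Proof. by []. Qed.

Lemma G2_quadric g : g \in chevalley_G2 F ->
  (val g)^T *m quadric F *m val g = quadric F.
Proof.
move: g; apply: generated_ind => [|a b Qa Qb|_ /imset2P[r xi _ _ ->]]; last exact: root_quadric.
  by rewrite trmx1 mul1mx mulmx1.
by rewrite val_mul trmx_mul -[RHS]Qb -[in RHS]Qa !mulmxA.
Qed.

Lemma G2_short g t : g \in chevalley_G2 F ->
  val g *m bivector 0 t *m (val g)^T = bivector 0 (val g *m t).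
Proof.
move=> Gg; move: g Gg t; apply: generated_ind => [t|a b Ca Cb t|_ /imset2P[r xi _ _ ->] t].
- by rewrite trmx1 !mul1mx mulmx1.
- by rewrite val_mul trmx_mul -[in RHS]mulmxA -Ca -Cb !mulmxA.
- exact: root_short.
Qed.

Lemma G2M : {in chevalley_G2 F &, forall a b, (a * b)%g \in chevalley_G2 F}.
Proof. by move=> a b; apply: groupM. Qed.
Section Sigma.
Variable sigma : {perm {'GL_7[F]}}.
Hypothesis Hsigma : exceptional_automorphism m sigma.

Lemma sigmaM : {in chevalley_G2 F &, {morph sigma : a b / (a * b)%g}}.
Proof. exact: (morphicP (Aut_morphic (proj1 Hsigma))). Qed.

Lemma x_in_G2 r xi : x r xi \in chevalley_G2 F.
Proof. by apply: mem_gen; apply: imset2_f. Qed.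

Lemma sigma_x r xi : sigma (x r xi) = x (bar r) (xi ^+ (lambda (bar r) * theta m)).
Proof. by case: Hsigma. Qed.

(** The relation between g and sigma(g) is stable under products since both
    [phi] and sigma are multiplicative, so it has to be checked on root elements
    only; there the (3 theta)-th power undoes the exponent theta of sigma. *)
Lemma G2_sigma g : g \in chevalley_G2 F -> forall s t, exists t',
  val g *m bivector s t *m (val g)^T = bivector (map_mx phi (val (sigma g)) *m s) t'.
Proof.
pose P g := g \in chevalley_G2 F /\ forall s t, exists t',
  val g *m bivector s t *m (val g)^T = bivector (map_mx phi (val (sigma g)) *m s) t'.
suff H : {in chevalley_G2 F, forall g, P g} by case/H.
apply: generated_ind => [|a b [Ga Pa] [Gb Pb]|_ /imset2P[r xi _ _ ->]]; rewrite {}/P.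
- split=> [|s t]; first exact: group1.
  have -> : sigma 1%g = 1%g.
    by apply: (mulgI (sigma 1%g)); rewrite -sigmaM ?group1 // !mulg1.
  by exists t; rewrite map_mx1 trmx1 !mul1mx mulmx1.
- split=> [|s t]; first exact: groupM.
  have [tb Eb] := Pb s t; have [ta Ea] := Pa (map_mx phi (val (sigma b)) *m s) tb.
  exists ta; rewrite sigmaM // !val_mul map_mxM -[in RHS]mulmxA -Ea -Eb.
  by rewrite trmx_mul !mulmxA.
split=> [|s t]; first exact: x_in_G2.
have [t' Et'] := root_bivector three0 r xi s t; exists t'; rewrite Et' sigma_x map_x_mx.
by rewrite exprM thetaK.
Qed.

Local Notation ree := (small_ree sigma).

Lemma reeE g : (g \in ree) = (g \in chevalley_G2 F) && (sigma g == g).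
Proof. by rewrite inE. Qed.

Lemma ree_group : group_set ree.
Proof.
apply/group_setP; split=> [|a b]; rewrite !reeE.
  rewrite group1; apply/eqP/(mulgI (sigma 1%g)).
  by rewrite -sigmaM ?group1 // !mulg1.
move=> /andP[Ga /eqP sa] /andP[Gb /eqP sb].
by rewrite G2M // sigmaM // sa sb eqxx.
Qed.
Canonical ree_grp := Group ree_group.

Lemma reeM : {in ree &, forall a b, (a * b)%g \in ree}.
Proof. by move=> a b; apply: (@groupM _ ree_grp). Qed.

Lemma ree_bivector g : g \in ree -> forall s t, exists t',
  val g *m bivector s t *m (val g)^T = bivector (map_mx phi (val g) *m s) t'.
Proof.
rewrite reeE => /andP[Gg /eqP sg] s t.
by have := G2_sigma Gg s t; rewrite sg.
Qed.

Lemma expr_theta1 (t : F) : t ^+ (theta m + 1) = t ^+ theta m * t.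
Proof. by rewrite exprD. Qed.
Lemma expr_2theta1 (t : F) : t ^+ (2 * theta m + 1) = t ^+ theta m * t ^+ theta m * t.
Proof. by rewrite mul2n -addnn !exprD. Qed.

Lemma sigma_xE : ((forall b xi, sigma (x (r_a, b) xi) = x (r_b, b) (phi xi))
  * (forall b xi, sigma (x (r_ab, b) xi) = x (r_3ab, b) (phi xi))
  * (forall b xi, sigma (x (r_2ab, b) xi) = x (r_3a2b, b) (phi xi))
  * (forall b xi, sigma (x (r_b, b) xi) = x (r_a, b) (xi ^+ theta m)%R)
  * (forall b xi, sigma (x (r_3ab, b) xi) = x (r_ab, b) (xi ^+ theta m)%R)
  * (forall b xi, sigma (x (r_3a2b, b) xi) = x (r_2ab, b) (xi ^+ theta m)%R))%type.
Proof.
by (split; [split; [split; [split; [split|]|]|]|]) => b xi;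
  rewrite sigma_x /bar /lambda /= ?mul1n /frob ?expnS.
Qed.

Lemma phiM : {morph phi : a b / a * b}.
Proof. exact: rmorphM. Qed.

Lemma phi_cube (t : F) : phi t = t ^+ theta m * (t ^+ theta m * t ^+ theta m).
Proof. by rewrite -[RHS]/((t ^+ theta m) ^+ 3) -exprM mulnC -expnS. Qed.

(** With a = t^theta, the (3 theta)-th power of a is t, and the exponents of
    sigma turn the statement into an identity of polynomials in t and a. *)
Lemma sigma_x1 (t : F) : sigma (x1 m t) = x1 m t.
Proof.
rewrite /x1 !sigmaM ?G2M ?x_in_G2 //.
rewrite expr_theta1 expr_2theta1 !sigma_xE !phiM !thetaK phi_cube.
apply: val_inj; rewrite !val_mul; set a := t ^+ theta m.
pose l := [:: t; a]; pose T := var 1; pose A := var 2.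
have chk : check_prod [:: root_term (r_b, false) T; root_term (r_a, false) A;
   root_term (r_3ab, false) (T * (A * (A * A)))%P;
   root_term (r_3a2b, false) (T * T * (A * (A * A)))%P]
  [:: root_term (r_a, false) A; root_term (r_b, false) T; root_term (r_ab, false) (A * T)%P;
      root_term (r_2ab, false) (A * A * T)%P] by vm_compute.
have := check_prodP three0 l chk; rewrite /foldr -!x_mxE !mulmx1 !mulmxA.
by [].
Qed.

Lemma sigma_x2 (u : F) : sigma (x2 m u) = x2 m u.
Proof.
rewrite /x2 !sigmaM ?G2M ?x_in_G2 // !sigma_xE thetaK.
apply: val_inj; rewrite !val_mul; set a := u ^+ theta m.
have chk : check_prod [:: root_term (r_3ab, false) (var 1); root_term (r_ab, false) (var 2)]
  [:: root_term (r_ab, false) (var 2); root_term (r_3ab, false) (var 1)] by vm_compute.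
by have := check_prodP three0 [:: u; a] chk; rewrite /foldr -!x_mxE !mulmx1.
Qed.

Lemma sigma_x3 (v : F) : sigma (x3 m v) = x3 m v.
Proof.
rewrite /x3 !sigmaM ?G2M ?x_in_G2 // !sigma_xE thetaK.
apply: val_inj; rewrite !val_mul; set a := v ^+ theta m.
have chk : check_prod [:: root_term (r_3a2b, false) (var 1); root_term (r_2ab, false) (var 2)]
  [:: root_term (r_2ab, false) (var 2); root_term (r_3a2b, false) (var 1)] by vm_compute.
by have := check_prodP three0 [:: v; a] chk; rewrite /foldr -!x_mxE !mulmx1.
Qed.

Lemma x_plus_ree t u v : x_plus m t u v \in ree.
Proof.
have G1 : x1 m t \in ree by rewrite reeE sigma_x1 eqxx andbT /x1 !G2M ?x_in_G2.
have G2 : x2 m u \in ree by rewrite reeE sigma_x2 eqxx andbT /x2 G2M ?x_in_G2.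
have G3 : x3 m v \in ree by rewrite reeE sigma_x3 eqxx andbT /x3 G2M ?x_in_G2.
exact: reeM (reeM G1 G2) G3.
Qed.

Definition weyl (r : posroot) : {'GL_7[F]} := x (r, false) 1 * x (r, true) (-1) * x (r, false) 1.

(** Both reduced words of the longest Weyl group element give w exactly,
    without a correction in the torus. *)
Lemma w_word (a : posroot) (b := posbar a) : a = r_a \/ a = r_b ->
  w F = (weyl a * weyl b * (weyl a * weyl b) * (weyl a * weyl b))%g.
Proof.
move=> simple_a; apply: val_inj; rewrite !val_mul.
pose W r := [:: root_term (r, false) 1%P; root_term (r, true) (PEopp 1); root_term (r, false) 1%P].
pose w_term := grid (fun i j => if (i + j == 6)%N then PEopp 1 else 0%P).
have chk : check_prod (W a ++ W b ++ W a ++ W b ++ W a ++ W b) [:: w_term].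
  by rewrite /b; case: simple_a => ->; vm_compute.
have := check_prodP three0 [::] chk; rewrite [foldr _ _ [:: w_term]]/= mulmx1 => E.
have wE : eval_mx [::] w_term = w_mx F.
  by apply/matrixP=> i j; rewrite !mxE entry_grid; case: eqP.
rewrite -[LHS]/(w_mx F) -wE -{}E /foldr /cat /W -!x_mxE mulmx1 !mulmxA.
by [].
Qed.

Lemma weyl_G2 r : weyl r \in chevalley_G2 F.
Proof. by rewrite !G2M ?x_in_G2. Qed.

Lemma w_ree : w F \in ree.
Proof.
have phiN1 : phi (-1) = -1 by rewrite rmorphN rmorph1.
have thN1 : (-1 : F) ^+ theta m = -1 by rewrite -{1}phiN1 phiK.
have sab : sigma (weyl r_a) = weyl r_b.
  by rewrite /weyl !sigmaM ?G2M ?x_in_G2 // !sigma_xE phiN1 rmorph1.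
have sba : sigma (weyl r_b) = weyl r_a.
  by rewrite /weyl !sigmaM ?G2M ?x_in_G2 // !sigma_xE thN1 expr1n.
have ab := w_word (or_introl (erefl r_a)); have ba := w_word (or_intror (erefl r_b)).
have [Gw sw] := fixed_braid sigmaM (weyl_G2 r_a) (weyl_G2 r_b) sab sba ab ba.
by rewrite reeE Gw sw eqxx.
Qed.

End Sigma.
End Group.

(** * Decomposable bivectors *)

Section Bivectors.
Variable F : finFieldType.
Local Notation "''e_' ( i , j )" := (E F i j) (format "''e_' ( i ,  j )").
Local Notation "v '_[' i ]" := (v (pos i) (0 : 'I_1)) (at level 2, format "v '_[' i ]").

Definition unit_cv (i : int) : 'cV[F]_7 := delta_mx (pos i) 0.
Definition wedge (a b : 'cV[F]_7) : 'M[F]_7 := a *m b^T - b *m a^T.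

Lemma wedgeE a b i j : wedge a b i j = a i 0 * b j 0 - b i 0 * a j 0.
Proof. by rewrite !mxE !big_ord1 !mxE. Qed.

Lemma mulmx_wedge (g : 'M_7) a b : g *m wedge a b *m g^T = wedge (g *m a) (g *m b).
Proof. by rewrite mulmxBr mulmxBl /wedge !trmx_mul !mulmxA. Qed.

Lemma unit_cvE k (i : 'I_7) (j : 'I_1) : unit_cv k i j = (i == pos k)%:R.
Proof. by rewrite mxE ord1 andbT. Qed.

Lemma wedge_unit i j : wedge (unit_cv i) (unit_cv j) = 'e_(i, j) - ('e_(i, j))^T.
Proof. by rewrite /wedge !trmx_delta !mul_delta_mx. Qed.

Lemma long0 : long_part (0 : 'cV[F]_7) = 0.
Proof. by rewrite /long_part !mxE !scale0r !subr0 !addr0. Qed.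
Lemma short0 : short_part (0 : 'cV[F]_7) = 0.
Proof. by rewrite /short_part !mxE !scale0r !subr0 !addr0. Qed.

Lemma bivector_long :
  ((bivector (unit_cv 1) 0 = wedge (unit_cv 1) (unit_cv 2)) *
   (bivector (unit_cv 2) 0 = - wedge (unit_cv 1) (unit_cv 3)) *
   (bivector (unit_cv 3) 0 = - wedge (unit_cv 2) (unit_cv (-3))) *
   (bivector (unit_cv (-3)) 0 = - wedge (unit_cv 3) (unit_cv (-2))))%type.
Proof.
rewrite !wedge_unit /bivector short0 !addr0 /long_part !unit_cvE /=.
rewrite !(scale1r, scale0r, subr0, addr0, add0r, sub0r).
by split; [split; [split|]|]; rewrite ?raddfN -?opprD.
Qed.

Lemma bivector_short (u := unit_cv) :
  ((bivector 0 (u 1) = wedge (u 1) (u 0) + wedge (u 2) (u 3))%R *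
   (bivector 0 (u 2) = wedge (u 1) (u (-3)) - wedge (u 2) (u 0))%R *
   (bivector 0 (u 3) = - wedge (u 1) (u (-2)) - wedge (u 3) (u 0))%R *
   (bivector 0 (u (-3)) = - wedge (u 2) (u (-1)) - wedge (u 0) (u (-3)))%R *
   (bivector 0 (u (-2)) = wedge (u 3) (u (-1)) - wedge (u 0) (u (-2)))%R)%type.
Proof.
rewrite /u !wedge_unit /bivector long0 !add0r /short_part !unit_cvE /=.
rewrite !(scale1r, scale0r, subr0, addr0, add0r, sub0r).
by split; [split; [split; [split|]|]|]; apply/matrixP=> i j; rewrite !mxE; ring.
Qed.

(** The entries that determine s modulo t, and the seven linear equations of the
    14-dimensional space of all [bivector s t]. *)
Lemma bivector_coords (s t : 'cV[F]_7) (A := bivector s t) (a := fun i j => A (pos i) (pos j) : F) :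
  (((a 1 2 = s _[1]) * (a 1 3 = - s _[2]) * (a 2 (-3) = - s _[3]) * (a 3 (-2) = - s _[-3])
  * (a (-3) (-1) = - s _[-2]) * (a (-2) (-1) = s _[-1])) *
  ((a 1 0 = a 2 3) * (a 1 (-3) = - a 2 0) * (a 1 (-2) = a 3 0) * (a 2 (-1) = a 0 (-3))
  * (a 3 (-1) = - a 0 (-2)) * (a 0 (-1) = a (-3) (-2)) * (a 1 (-1) = s _[0] - a 3 (-3))%R))%type.
Proof.
rewrite {}/a {}/A; have [] := vars_eval 0 s t; set l := _ :: _ => _ -> ->.
rewrite bivectorE.
repeat match goal with |- (_ * _)%type => split end; rewrite !mxE /eval_mx /=; ring.
Qed.

End Bivectors.

(** * Flags fixed by the polarity *)

Section Flags.
Variable F : finFieldType.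
Local Notation "v '_[' i ]" := (v (pos i) (0 : 'I_1)) (at level 2, format "v '_[' i ]").

Lemma mul0_neq (a b : F) : b != 0 -> a * b = 0 -> a = 0.
Proof. by move=> b0 /eqP; rewrite mulf_eq0 (negPf b0) orbF => /eqP. Qed.

Hypothesis three0 : 3%:R = 0 :> F.

Definition polar (p q : 'cV[F]_7) : F :=
  p _[1] * q _[-1] + p _[-1] * q _[1] + p _[2] * q _[-2] + p _[-2] * q _[2]
  + p _[3] * q _[-3] + p _[-3] * q _[3] - p _[0] * q _[0].

(** Derives A = B from an equation L = R, of which A = B is a multiple; what
    remains is a ring identity. *)
Lemma lincomb (c L R A B : F) : L = R -> A - B = c * (L - R) -> A = B.
Proof. by move=> -> /eqP; rewrite subrr mulr0 subr_eq0 => /eqP. Qed.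

Lemma sqr0 (c : F) : c * c = 0 -> c = 0.
Proof. by move/eqP; rewrite mulf_eq0 orbb => /eqP. Qed.

Lemma double0 (c : F) : c + c = 0 -> c = 0.
Proof.
move=> cc; have : c * 3%:R = 0 by rewrite three0 mulr0.
by rewrite mulr_natr mulrS mulr2n cc addr0.
Qed.

Variable phi : {rmorphism F -> F}.

(** Here p and q stand for the first two columns of an element of the Ree group:
    the polarity maps the point of p to the line through p and q. *)
Section AbsoluteFlag.
Variables p q t : 'cV[F]_7.
Hypothesis pp0 : polar p p = 0.
Hypothesis pq0 : polar p q = 0.
Hypothesis flag : wedge p q = bivector (map_mx phi p) t.

Let minor i j : wedge p q (pos i) (pos j) = p _[i] * q _[j] - q _[i] * p _[j].
Proof. exact: wedgeE. Qed.

Let plucker := bivector_coords (map_mx phi p) t.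

Let phi_eq0 a : phi a = 0 -> a = 0.
Proof. by move/eqP; rewrite fmorph_eq0 => /eqP. Qed.

(** The minors of p and q at the long roots are powers of the coordinates of p,
    hence these vanish one after the other, starting from the index -1.  If the
    coordinate -1 of q is not 0, dividing by it settles everything; otherwise
    each step divides by a further coordinate of q, or that coordinate is 0 and
    the minors simplify. *)
Lemma flag_in_hyperplane : p _[-1] = 0 ->
  [/\ p _[2] = 0, p _[3] = 0 & [/\ p _[0] = 0, p _[-3] = 0 & p _[-2] = 0]].
Proof.
move=> pm1; have [] := plucker; rewrite -!flag !minor !mxE.
move=> [[[[[_ m13] m23'] m32'] m3'1'] m2'1'] [[[[[[m10 m13'] _] m21'] m31'] m01'] _].
move: pp0 pq0 m13 m23' m32' m3'1' m2'1' m10 m13' m21' m31' m01'.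
rewrite /polar pm1.
move: (p (pos 1) 0) (p (pos 2) 0) (p (pos 3) 0) (p (pos 0) 0) (p (pos (-3)) 0) (p (pos (-2)) 0).
move: (q (pos 1) 0) (q (pos 2) 0) (q (pos 3) 0) (q (pos 0) 0) (q (pos (-3)) 0) (q (pos (-2)) 0)
  (q (pos (-1)) 0) => q1 q2 q3 q0 q3' q2' q1' p1 p2 p3 p0 p3' p2'.
rewrite !(mulr0, mul0r, subr0, addr0, add0r).
move=> pp pq m13 m23' m32' m3'1' m2'1' m10 m13' m21' m31' m01'.
rewrite rmorph0 in m2'1'.
have [q1'0|q1'n] := eqVneq q1' 0; last first.
  have p2'0 := mul0_neq q1'n m2'1'; subst p2'.
  rewrite rmorph0 oppr0 in m3'1'; have p3'0 := mul0_neq q1'n m3'1'; subst p3'.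
  have p00 : p0 = 0 by apply: sqr0; apply: (lincomb (c := -1) pp); ring.
  subst p0; split=> //; apply: (mul0_neq q1'n).
    by rewrite m21' mulr0 mul0r subrr.
  by rewrite m31' mulr0 mul0r subrr oppr0.
subst q1'; have p2'0 : p2' = 0.
  by apply: phi_eq0; apply: (lincomb (c := 1) m3'1'); ring.
subst p2'; have p3'0 : p3' = 0.
  have [q2'0|q2'n] := eqVneq q2' 0; last first.
    by apply: (mul0_neq q2'n); apply: (lincomb (c := -1) m01'); ring.
  by apply: phi_eq0; apply: (lincomb (c := 1) m32'); rewrite q2'0; ring.
subst p3'; have p00 : p0 = 0 by apply: sqr0; apply: (lincomb (c := -1) pp); ring.
subst p0; rewrite rmorph0 in m32'.
have p3q2' : p3 * q2' = 0 by apply: (lincomb (c := 1) m32'); ring.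
have p30 : p3 = 0.
  have [q2'0|/mul0_neq] := eqVneq q2' 0; last exact.
  have p3q3' : p3 * q3' = 0 by apply: (lincomb (c := 1) pq); rewrite q2'0; ring.
  have [q3'0|/mul0_neq] := eqVneq q3' 0; last exact.
  by apply: phi_eq0; apply: (lincomb (c := 1) m23'); rewrite q3'0; ring.
subst p3; rewrite rmorph0 in m23'; split=> //.
have p2q3' : p2 * q3' = 0 by apply: (lincomb (c := 1) m23'); ring.
have [q3'0|/mul0_neq] := eqVneq q3' 0; last exact.
have p2q0 : p2 * q0 = 0 by apply: (lincomb (c := 1) m13'); rewrite q3'0; ring.
have [q00|/mul0_neq] := eqVneq q0 0; last exact.
have p2q3 : p2 * q3 = 0 by apply: (lincomb (c := -1) m10); rewrite q00; ring.
have [q30|/mul0_neq] := eqVneq q3 0; last exact.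
by apply: phi_eq0; apply: (lincomb (c := 1) m13); rewrite q30; ring.
Qed.

(** U acts regularly on the absolute points off the hyperplane, and the
    coordinates -2, -3 and 0 are the ones that U can move to 0; then the equation
    of the quadric and the minors at the long roots leave no choice. *)
Lemma flag_opposite : p _[-1] != 0 -> p _[-2] = 0 -> p _[-3] = 0 -> p _[0] = 0 ->
  [/\ p _[1] = 0, p _[2] = 0 & p _[3] = 0].
Proof.
move=> p1'n p2'0 p3'0 p00; have [] := plucker; rewrite -!flag !minor !mxE.
move=> [[[[[_ m13] m23'] _] m3'1'] _] _.
move: p1'n pp0 m13 m23' m3'1'; rewrite /polar p2'0 p3'0 p00.
move: (p (pos 1) 0) (p (pos 2) 0) (p (pos 3) 0) (p (pos (-1)) 0) => p1 p2 p3 p1'.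
move: (q (pos 1) 0) (q (pos 2) 0) (q (pos 3) 0) (q (pos (-3)) 0) => q1 q2 q3 q3'.
move=> p1'n pp m13 m23' m3'1'; rewrite rmorph0 in m3'1'.
have p10 : p1 = 0.
  by apply: (mul0_neq p1'n); apply: double0; apply: (lincomb (c := 1) pp); ring.
have q3'0 : q3' = 0 by apply: (mul0_neq p1'n); apply: (lincomb (c := -1) m3'1'); ring.
have p30 : p3 = 0 by apply: phi_eq0; apply: (lincomb (c := 1) m23'); rewrite q3'0; ring.
have p20 : p2 = 0 by apply: phi_eq0; apply: (lincomb (c := 1) m13); rewrite p10 p30; ring.
by [].
Qed.

End AbsoluteFlag.
End Flags.

(** * Columns of an element of the Ree group *)

Section Columns.
Variable F : finFieldType.
Local Notation "''e_' ( i , j )" := (E F i j) (format "''e_' ( i ,  j )").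
Local Notation "v '_[' i ]" := (v (pos i) (0 : 'I_1)) (at level 2, format "v '_[' i ]").
Variable phi : {rmorphism F -> F}.
Local Notation u := (@unit_cv F).

Lemma polarE (p q : 'cV[F]_7) : (p^T *m quadric F *m q) 0 0 = polar p q.
Proof.
have eE i j : (p^T *m 'e_(i, j) *m q) 0 0 = p _[i] * q _[j].
  rewrite mxE (bigD1 (pos j)) //= big1 ?addr0 => [|k kj]; rewrite mxE.
    rewrite (bigD1 (pos i)) //= big1 ?addr0 => [|l li]; rewrite !mxE ?eqxx ?mulr1 //.
    by rewrite (negPf li) mulr0.
  by rewrite big1 ?mul0r // => l _; rewrite !mxE (negPf kj) andbF mulr0.
rewrite /quadric /polar !(mulmxDr, mulmxDl, mulmxN, mulNmx).
by rewrite ![(_ + _ : 'M_1) 0 0]mxE [(- _ : 'M_1) 0 0]mxE !eE; ring.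
Qed.

(** The relations between the entries of an element of the Ree group from which
    the orbit and the stabiliser of e_1 are determined. *)
Definition ree_mx (g : 'M[F]_7) : Prop :=
  [/\ g^T *m quadric F *m g = quadric F,
      forall t, g *m bivector 0 t *m g^T = bivector 0 (g *m t)
    & forall s t, exists t', g *m bivector s t *m g^T = bivector (map_mx phi g *m s) t'].

Section ReeMatrix.
Variable g : 'M[F]_7.
Hypothesis ree_g : ree_mx g.
Local Notation c i := (g *m u i).

Lemma ree_polar p q : polar (g *m p) (g *m q) = polar p q.
Proof.
by case: ree_g => Qg _ _; rewrite -!polarE -[in RHS]Qg trmx_mul !mulmxA.
Qed.

Lemma ree_long i : exists t, g *m bivector (u i) 0 *m g^T = bivector (map_mx phi (c i)) t.
Proof.
case: ree_g => _ _ /(_ (u i) 0)[t ->]; exists t.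
by rewrite map_mxM map_delta_mx.
Qed.

Lemma ree_long1 : exists t, wedge (c 1) (c 2) = bivector (map_mx phi (c 1)) t.
Proof. by have [t] := ree_long 1; rewrite bivector_long mulmx_wedge; exists t. Qed.
Lemma ree_long2 : exists t, - wedge (c 1) (c 3) = bivector (map_mx phi (c 2)) t.
Proof. by have [t] := ree_long 2; rewrite bivector_long mulmxN mulNmx mulmx_wedge; exists t. Qed.
Lemma ree_long3 : exists t, - wedge (c 2) (c (-3)) = bivector (map_mx phi (c 3)) t.
Proof. by have [t] := ree_long 3; rewrite bivector_long mulmxN mulNmx mulmx_wedge; exists t. Qed.
Lemma ree_longN3 : exists t, - wedge (c 3) (c (-2)) = bivector (map_mx phi (c (-3))) t.
Proof. by have [t] := ree_long (-3); rewrite bivector_long mulmxN mulNmx mulmx_wedge; exists t. Qed.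

Lemma ree_short :
  ((wedge (c 1) (c 0) + wedge (c 2) (c 3) = bivector 0 (c 1))%R *
   (wedge (c 1) (c (-3)) - wedge (c 2) (c 0) = bivector 0 (c 2))%R *
   (- wedge (c 1) (c (-2)) - wedge (c 3) (c 0) = bivector 0 (c 3))%R *
   (- wedge (c 2) (c (-1)) - wedge (c 0) (c (-3)) = bivector 0 (c (-3)))%R *
   (wedge (c 3) (c (-1)) - wedge (c 0) (c (-2)) = bivector 0 (c (-2)))%R)%type.
Proof.
case: ree_g => _ C _; rewrite -!mulmx_wedge -!C !bivector_short.
by rewrite !(mulmxDr, mulmxDl, mulmxN, mulNmx).
Qed.

Lemma col_entry i j : c j i 0 = g i (pos j).
Proof. by rewrite -colE mxE. Qed.

Lemma posP (i : 'I_7) : exists2 k, k \in labels & i = pos k.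
Proof.
exists (nth 0 labels i); first exact: mem_nth.
by apply: val_inj; case: i => [[|[|[|[|[|[|[|i]]]]]]] hi].
Qed.

Lemma cv7P (a b : 'cV[F]_7) : a _[1] = b _[1] -> a _[2] = b _[2] -> a _[3] = b _[3] ->
  a _[0] = b _[0] -> a _[-3] = b _[-3] -> a _[-2] = b _[-2] -> a _[-1] = b _[-1] -> a = b.
Proof.
move=> e1 e2 e3 e0 e3' e2' e1'; apply/matrixP=> i j; rewrite ord1.
have [k + ->] := posP i; rewrite !inE.
by case/or4P=> [|||/or4P[|||]] /eqP->.
Qed.

Lemma wedge_unitI i (a b : 'cV[F]_7) :
  wedge (u i) a = wedge (u i) b -> a _[i] = b _[i] -> a = b.
Proof.
move=> ab abi; apply/matrixP=> k j; rewrite ord1.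
have [->//|ki] := eqVneq k (pos i).
have := congr1 (fun A : 'M_7 => A (pos i) k) ab.
by rewrite !wedgeE !unit_cvE eqxx (negPf ki) !mul1r !mulr0 !subr0.
Qed.

Hypothesis c1 : c 1 = u 1.

(** When g fixes e_1, the bivector of the first two columns has nonzero entries
    in the row and the column of e_1 only.  Every weight of the short part occurs
    in an entry outside of these, so that its coefficient is 0, and the
    coefficients at the long roots are powers of the coordinates of e_1. *)
Lemma ree_col2 : c 2 = g (pos 1) (pos 2) *: u 1 + u 2.
Proof.
have [t] := ree_long1; rewrite c1 map_delta_mx => H.
have [] := bivector_coords (u 1) t; rewrite -H !wedgeE !unit_cvE /=.
rewrite !(mul1r, mul0r, mulr0, subr0, oppr0, addr0).
move=> [[[[[a12 a13] _] a32] _] _] [[[[[[a10 a13'] a12'] _] _] _] a11'].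
by apply: cv7P; rewrite [RHS]mxE [X in _ = X + _]mxE !unit_cvE /=
  ?(mulr0, mulr1, add0r, addr0) ?col_entry //;
  rewrite -?col_entry.
Qed.

Lemma ree_col3 : c 2 = u 2 -> c 3 = g (pos 1) (pos 3) *: u 1 + u 3.
Proof.
move=> c2; have [t] := ree_long2; rewrite c1 c2 map_delta_mx => H.
have [] := bivector_coords (u 2) t; rewrite -H ![(- _ : 'M_7) _ _]mxE !wedgeE !unit_cvE /=.
rewrite !(mul1r, mul0r, mulr0, subr0, oppr0, addr0).
move=> [[[[[a12 a13] _] a32] _] _] [[[[[[a10 a13'] a12'] _] _] _] a11'].
by apply: cv7P; rewrite [RHS]mxE [X in _ = X + _]mxE !unit_cvE /=
  ?(mulr0, mulr1, add0r, addr0) ?col_entry //;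
  rewrite -?col_entry; apply: oppr_inj; rewrite ?oppr0.
Qed.

Lemma ree_col0 : c 2 = u 2 -> c 3 = u 3 -> c 0 = g (pos 1) (pos 0) *: u 1 + u 0.
Proof.
move=> c2 c3; apply: (@wedge_unitI 1); last first.
  by rewrite [RHS]mxE [X in _ = X + _]mxE !unit_cvE /= mulr1 addr0 col_entry.
transitivity (wedge (u 1) (u 0)).
  apply: (addIr (wedge (u 2) (u 3))).
  by have := ree_short.1.1.1.1; rewrite c1 c2 c3 bivector_short.
rewrite /wedge linearD linearZ /= mulmxDr mulmxDl -scalemxAr -scalemxAl.
by rewrite opprD addrACA subrr add0r.
Qed.

(** The columns are treated in the order 1, 2, 3, 0, -3, -2, -1.  Each relation
    between columns leaves only the multiple of one known unit vector open.  For
    the columns -3 and -2 it is the coordinate 1, which is excluded by a minor at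
    a long root; this is the place where elements such as x_(3 alpha + beta)(xi),
    which are in the group of type G2 and not fixed by sigma, drop out. *)
Lemma ree_unipotent : g (pos 1) (pos 2) = 0 -> g (pos 1) (pos 3) = 0 ->
  g (pos 1) (pos 0) = 0 -> g = 1%:M.
Proof.
move=> g12 g13 g10.
have c2 : c 2 = u 2 by rewrite ree_col2 g12 scale0r add0r.
have c3 : c 3 = u 3 by rewrite ree_col3 // g13 scale0r add0r.
have c0 : c 0 = u 0 by rewrite ree_col0 // g10 scale0r add0r.
have [[[[_ C2] C3] C3'] C2'] := ree_short.
have c3' : c (-3) = u (-3).
  apply: (@wedge_unitI 1).
    by apply: (addIr (- wedge (u 2) (u 0))); rewrite -bivector_short -c2 -C2 c1 c2 c0.
  have [t] := ree_long3; rewrite c2 c3 map_delta_mx => H.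
  have [[[[[[+ _] _] _] _] _] _] := bivector_coords (u 3) t.
  rewrite -H [(- _ : 'M_7) _ _]mxE !wedgeE !unit_cvE /=.
  by rewrite mul0r mulr1 sub0r opprK.
have c2' : c (-2) = u (-2).
  apply: (@wedge_unitI 1).
    apply: oppr_inj; apply: (addIr (- wedge (u 3) (u 0))).
    by rewrite -bivector_short -c3 -C3 c1 c3 c0.
  have [t] := ree_longN3; rewrite c3 c3' map_delta_mx => H.
  have [[[[[[_ +] _] _] _] _] _] := bivector_coords (u (-3)) t.
  rewrite -H [(- _ : 'M_7) _ _]mxE !wedgeE !unit_cvE /=.
  by rewrite mul0r mulr1 sub0r opprK oppr0.
have c1' : c (-1) = u (-1).
  have W2 : wedge (u 2) (c (-1)) = wedge (u 2) (u (-1)).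
    apply: oppr_inj; apply: (addIr (- wedge (u 0) (u (-3)))).
    by rewrite -bivector_short -c3' -C3' c2 c0 c3'.
  have W3 : wedge (u 3) (c (-1)) = wedge (u 3) (u (-1)).
    by apply: (addIr (- wedge (u 0) (u (-2)))); rewrite -bivector_short -c2' -C2' c3 c0 c2'.
  apply: (wedge_unitI W2).
  have := congr1 (fun A : 'M_7 => A (pos 3) (pos 2)) W3.
  by rewrite !wedgeE !unit_cvE /= !mul1r !mulr0 !subr0.
apply/matrixP=> i j; have [k + ->] := posP j; rewrite !inE => k_label.
have ck : c k = u k by case/or4P: k_label => [|||/or4P[|||]] /eqP->.
by rewrite -col_entry ck unit_cvE mxE.
Qed.

End ReeMatrix.
End Columns.

(** * Four factors from corners *)

(** A group G acts on a space with a vector e: [scales c g] says that g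
    multiplies e by c, and [corner g] is a coordinate of g e.  If it is 0, then g
    scales e, and otherwise an element of U moves g e into the line of w e: this
    is the Bruhat decomposition.  Elements of G that fix e are in U. *)
Section Abstract.
Local Open Scope group_scope.
Variables (gT : finGroupType) (G : {group gT}) (U : {set gT}) (w : gT).
Variables (K : fieldType) (corner : gT -> K) (scales : K -> gT -> Prop).
Hypotheses (sUG : U \subset G) (Gw : w \in G) (ww : w * w = 1).
Hypothesis scalesM : forall a b g h, scales a g -> scales b h -> scales (a * b)%R (g * h).
Hypothesis scalesV : forall a g, a != 0%R -> scales a g -> scales a^-1%R g^-1.
Hypothesis mem_U : forall g, g \in G -> scales 1%R g -> g \in U.
Hypothesis corner0 : forall g, g \in G -> corner g = 0%R ->
  exists2 c, c != 0%R & scales c g.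
Hypothesis cornerN0 : forall g, g \in G -> corner g != 0%R ->
  exists2 x, x \in U & scales (- corner g)%R (w * (x^-1 * g)).
Hypothesis corner_onto : forall c, c != 0%R ->
  exists2 y, y \in U & corner (w * y * w) = c.

Let U_G x : x \in U -> x \in G. Proof. exact: (subsetP sUG). Qed.
Hypothesis UV : forall x, x \in U -> x^-1 \in U.
Hypothesis UM : forall x y, x \in U -> y \in U -> x * y \in U.

(** If w y w = x w b with x in U and b scaling e, then b is the product of
    w x^-1 and w y w, and the scalar of b is minus the corner of w y w. *)
Lemma dilation c : c != 0%R ->
  exists x y, [/\ x \in U, y \in U & scales c (w * x * (w * y * w))].
Proof.
move=> c_neq0; have [|y Uy yE] := corner_onto (c := (- c)%R); first by rewrite oppr_eq0.
have Gy : w * y * w \in G by rewrite !groupM // U_G.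
have [|x Ux] := cornerN0 Gy; first by rewrite yE oppr_eq0.
by rewrite yE opprK mulgA => xE; exists x^-1, y; rewrite UV.
Qed.

(** If g scales e, it differs by an element of U from the element of [dilation]
    with the same scalar.  Otherwise g is in U w g1 with g1 scaling e; a single
    element of [dilation] would give only two factors w, so that g1 is compared
    with a product of two of them, the second one with scalar 1. *)
Lemma bruhat_words g : g \in G ->
  exists a b c d, [/\ a \in U, b \in U, c \in U, d \in U & g = a * w * b * w * c * w * d].
Proof.
move=> Gg; have mem_Uquo c h k : c != 0%R -> h \in G -> k \in G ->
    scales c h -> scales c k -> h * k^-1 \in U.
  move=> c0 Gh Gk ch ck; apply: mem_U; first by rewrite groupM ?groupV.
  by rewrite -(mulfV c0); apply: scalesM => //; apply: scalesV.
have U1 : 1 \in U.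
  have [x [y [Ux _ _]]] := dilation (oner_neq0 K).
  by rewrite -(mulgV x) UM ?UV.
have [g0|g0] := eqVneq (corner g) 0%R.
  have [c c0 cg] := corner0 Gg g0; have [x [y [Ux Uy cb]]] := dilation c0.
  set b := w * x * _ in cb; have Gb : b \in G by rewrite !groupM // U_G.
  exists (g * b^-1), x, y, 1; split=> //; first exact: mem_Uquo cg cb.
  by rewrite mulg1 -{1}(mulgKV b g) /b !mulgA.
have [x Ux] := cornerN0 Gg g0; set c := (- corner g)%R; set g1 := w * _ => cg1.
have Gg1 : g1 \in G by rewrite !groupM // groupV U_G.
have c0 : c != 0%R by rewrite oppr_eq0.
have [x0 [y0 [Ux0 Uy0 cb]]] := dilation c0.
have [x1 [y1 [Ux1 Uy1 c1b]]] := dilation (oner_neq0 K).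
set b := w * x0 * _ in cb; set b1 := w * x1 * _ in c1b.
have Gb : b * b1 \in G by rewrite !groupM // U_G.
have cbb : scales c (b * b1) by rewrite -[c]mulr1; apply: scalesM.
pose k := (b * b1)^-1 * g1; exists (x * x0), (y0 * x1), y1, k.
split=> //; [exact: UM|exact: UM| |].
  apply: mem_U; first by rewrite groupM ?groupV.
  by rewrite -(mulVf c0); apply: scalesM => //; apply: scalesV.
have wwK h : h * w * w = h by rewrite -mulgA ww mulg1.
have -> : g = x * w * g1 by rewrite /g1 !mulgA wwK mulgV mul1g.
have -> : g1 = b * b1 * k by rewrite mulKVg.
by rewrite /b /b1 !mulgA !wwK.
Qed.

Lemma four_factors (V := [set w * x * w^-1 | x in U]) : G :=: U * V * U * V.
Proof.
have wV : w^-1 = w by apply/eqP; rewrite eq_invg_mul ww.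
apply/setP=> g; apply/idP/idP => [Gg|].
  have [a [b [c [d [Ua Ub Uc Ud gE]]]]] := bruhat_words (groupM Gg Gw).
  have -> : g = a * (w * b * w^-1) * c * (w * d * w^-1).
    by rewrite wV !mulgA -gE -mulgA ww mulg1.
  have VU x : x \in U -> w * x * w^-1 \in V by move=> Ux; apply/imsetP; exists x.
  exact: mem_mulg (mem_mulg (mem_mulg Ua (VU _ Ub)) Uc) (VU _ Ud).
case/mulsgP=> _ _ /mulsgP[_ c /mulsgP[a _ Ua /imsetP[b Ub ->] ->] Uc ->] /imsetP[d Ud ->] ->.
move: (U_G Ua) (U_G Ub) (U_G Uc) (U_G Ud) => Ga Gb Gc Gd.
by rewrite wV !groupM.
Qed.
End Abstract.

(** * The elements of U *)

Lemma x_rowE (F : finFieldType) (l : seq F) A p i :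
  (eval_mx l A *m eval_cv l p) (pos i) 0 = eval l (nth 0%P (app_term A p) (pos i)).
Proof. by rewrite app_termE mxE. Qed.

Lemma vars6_eval (F : finFieldType) (a1 a2 a3 a4 a5 a6 : F) (p : 'cV[F]_7)
  (l := [:: a1, a2, a3, a4, a5, a6 & coords p]) : p = eval_cv l (vars 6).
Proof.
apply/matrixP=> i j; rewrite ord1 mxE -{1}(inord_val i).
by case: i => [[|[|[|[|[|[|[|i]]]]]]] hi].
Qed.

(** The matrix of x_1(t) x_2(u) x_3(v), with T, U, V for the theta-th powers. *)
Definition unipotent_term (t T u U v V : pterm) : seq (seq pterm) := grid (sparse
 [:: (1, 2, T); (1, 3, U); (1, 0, T * U - V); (1, -3, t * (T * T * T) + T * V + u);
   (1, -2, - (t * t * (T * T * T) + T * (U * U) + U * V + v));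
   (1, -1, t * t * (T * T * T * T) - t * (T * T * T) * U - T * U * V + T * v - U * u - V * V);
   (2, 3, - t); (2, 0, t * T + U); (2, -3, t * (T * T) + V);
   (2, -2, t * T * U + t * V - U * U);
   (2, -1, - (t * T * V + t * (T * T) * U - t * u + t * t * (T * T * T) + U * V - v));
   (3, 0, - T); (3, -3, - (T * T)); (3, -2, - (T * U + V));
   (3, -1, - (t * (T * T * T)) + T * V + T * T * U - u);
   (0, -3, - T); (0, -2, U); (0, -1, T * U - V);
   (-3, -2, t); (-3, -1, - (t * T + U)); (-2, -1, - T)]%Z%P).

Section UElements.
Variables (m : nat) (F : finFieldType).
Hypothesis cardF : #|F| = (3 ^ (2 * m + 1))%N.
Local Notation "v '_[' i ]" := (v (pos i) (0 : 'I_1)) (at level 2, format "v '_[' i ]").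
Local Notation u := (@unit_cv F).
Let three0 : 3%:R = 0 :> F.
Proof. by rewrite pcharf0 ?(char3 cardF). Qed.

Lemma x_plusE (a b c : F) r (T := a ^+ theta m) (U := b ^+ theta m) (V := c ^+ theta m) :
  val (x_plus m a b c) = eval_mx [:: a, T, b, U, c, V & r]
    (unipotent_term (var 1) (var 2) (var 3) (var 4) (var 5) (var 6)).
Proof.
set l := [:: _, _, _, _, _, _ & r].
have chk : check_prod
  [:: root_term (r_a, false) (var 2); root_term (r_b, false) (var 1);
      root_term (r_ab, false) (var 2 * var 1)%P;
      root_term (r_2ab, false) (var 2 * var 2 * var 1)%P;
      root_term (r_ab, false) (var 4); root_term (r_3ab, false) (var 3);
      root_term (r_2ab, false) (var 6); root_term (r_3a2b, false) (var 5)]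
  [:: unipotent_term (var 1) (var 2) (var 3) (var 4) (var 5) (var 6)].
  by vm_compute.
have := check_prodP three0 l chk; rewrite /foldr -!x_mxE !mulmx1 => <-.
rewrite /x_plus /x1 /x2 /x3 expr_theta1 expr_2theta1 !val_mul -!mulmxA.
by [].
Qed.

(** The rows used to solve for the parameters: T, U, V appear successively as the
    coefficients of the last coordinate in the rows -2, -3, 0, and again of the
    coordinates 2, 3, 0 in the first row. *)
Lemma x_plus_rows (a b c : F) p (T := a ^+ theta m) (U := b ^+ theta m) (V := c ^+ theta m)
  (xp := val (x_plus m a b c) *m p) :
  [/\ xp _[1] = p _[1] + T * p _[2] + U * p _[3] + (T * U - V) * p _[0]
       + (a * (T * T * T) + T * V + b) * p _[-3]
       - (a * a * (T * T * T) + T * (U * U) + U * V + c) * p _[-2]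
       + (a * a * (T * T * T * T) - a * (T * T * T) * U - T * U * V + T * c - U * b - V * V)
         * p _[-1],
     xp _[0] = p _[0] - T * p _[-3] + U * p _[-2] + (T * U - V) * p _[-1],
     xp _[-3] = p _[-3] + a * p _[-2] - (a * T + U) * p _[-1],
     xp _[-2] = p _[-2] - T * p _[-1] & xp _[-1] = p _[-1]].
Proof.
rewrite {}/xp (x_plusE _ _ _ (coords p)) -/T -/U -/V.
have := vars6_eval a T b U c V p; set l := _ :: _ => ->.
split; rewrite [LHS]x_rowE ![(eval_cv _ _) _ _]mxE /=; ring.
Qed.
End UElements.

(** * Bruhat decomposition and corners *)

Section Ree.
Variables (m : nat) (F : finFieldType).
Hypothesis cardF : #|F| = (3 ^ (2 * m + 1))%N.
Variable sigma : {perm {'GL_7[F]}}.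
Hypothesis Hsigma : exceptional_automorphism m sigma.
Local Notation "v '_[' i ]" := (v (pos i) (0 : 'I_1)) (at level 2, format "v '_[' i ]").
Local Notation u := (@unit_cv F).
Let three0 : 3%:R = 0 :> F.
Proof. by rewrite pcharf0 ?(char3 cardF). Qed.
Local Notation phi := (frob (char3 cardF) m.+1).
Local Notation ree := (small_ree sigma).

Lemma ree_mxP g : g \in ree -> ree_mx phi (val g).
Proof.
move=> ree_g; have := ree_g; rewrite reeE => /andP[Gg _]; split.
- exact: (G2_quadric cardF Gg).
- by move=> t; apply: (G2_short cardF).
- exact: (ree_bivector cardF Hsigma ree_g).
Qed.

Lemma mem_ree_mulV x g : x \in ree -> g \in ree -> (x^-1 * g)%g \in ree.
Proof.
rewrite -[ree]/(gval (ree_grp Hsigma)) => ree_x ree_g.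
by rewrite groupM ?groupV.
Qed.

Definition scales (c : F) (g : {'GL_7[F]}) := val g *m u 1 = c *: u 1.
Definition corner (g : {'GL_7[F]}) : F := val g (pos (-1)) (pos 1).

Lemma scalesM a b g h : scales a g -> scales b h -> scales (a * b) (g * h)%g.
Proof.
by rewrite /scales => ga hb; rewrite val_mul -mulmxA hb -scalemxAr ga scalerA mulrC.
Qed.

Lemma val_invK (g : {'GL_7[F]}) (p : 'cV[F]_7) : val g^-1%g *m (val g *m p) = p.
Proof. by rewrite mulmxA -val_mul mulVg mul1mx. Qed.

Lemma val_mulVK (x g : {'GL_7[F]}) (p : 'cV[F]_7) :
  val g *m p = val x *m (val (x^-1 * g)%g *m p).
Proof. by rewrite mulmxA -val_mul mulKVg. Qed.

Lemma scalesV a g : a != 0 -> scales a g -> scales a^-1 g^-1%g.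
Proof.
move=> a0; rewrite /scales => ga; rewrite -[in LHS](scale1r (u 1)) -(mulVf a0) -scalerA -ga.
by rewrite -scalemxAr val_invK.
Qed.

Lemma w_unit : (w_mx F *m u 1 = - u (-1)) * (w_mx F *m u (-1) = - u 1).
Proof.
by split; apply/matrixP=> i j; rewrite -colE !mxE ord1 andbT;
  case: i => [[|[|[|[|[|[|[|i]]]]]]] hi] //=; rewrite ?oppr0.
Qed.

Lemma unit_cv_mul (g : 'M[F]_7) i j : (g *m u j) i 0 = g i (pos j).
Proof. exact: col_entry. Qed.

Lemma ree_neq0 (g : {'GL_7[F]}) : val g *m u 1 <> 0.
Proof.
move=> g0; have := val_invK g (u 1); rewrite g0 mulmx0 => /matrixP/(_ (pos 1) 0).
by rewrite unit_cvE mxE eqxx => /eqP; rewrite eq_sym oner_eq0.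
Qed.

Lemma ree_flag g : g \in ree -> let p := val g *m u 1 in let q := val g *m u 2 in
  [/\ polar p p = 0, polar p q = 0 & exists t, wedge p q = bivector (map_mx phi p) t].
Proof.
move=> /ree_mxP ree_g p q; rewrite /p /q !(ree_polar ree_g).
split; try by rewrite /polar !unit_cvE /= !(mulr0, mul0r, addr0, subr0).
exact: ree_long1.
Qed.

Lemma corner0 g : g \in ree -> corner g = 0 -> exists2 c, c != 0 & scales c g.
Proof.
move=> ree_g; rewrite /corner -unit_cv_mul => g0.
have [pp0 pq0 [t flag]] := ree_flag ree_g.
have [p2 p3 [p0 p3' p2']] := flag_in_hyperplane pp0 pq0 flag g0.
set p := val g *m u 1 in p2 p3 p0 p3' p2' g0.
have pE : p = p _[1] *: u 1.
  by apply: cv7P; rewrite [RHS]mxE unit_cvE /= ?mulr1 ?mulr0.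
exists (p _[1]) => //; apply/eqP=> p1; apply: (@ree_neq0 g).
by rewrite -/p pE p1 scale0r.
Qed.

Lemma theta_onto (a : F) : exists t, t ^+ theta m = a.
Proof. by exists (phi a); apply: phiK. Qed.

(** The theta-th power map being onto, the parameters of x are determined in
    turn by the coordinates -2, -3 and 0 of x^-1 g e_1, which they make 0. *)
Lemma cornerN0 g : g \in ree -> corner g != 0 ->
  exists2 x, x \in U F m & scales (- corner g) (w F * (x^-1 * g))%g.
Proof.
move=> ree_g; rewrite /corner -unit_cv_mul; set p := val g *m u 1; set c := p _[-1] => c0.
have [a aE] := theta_onto (- p _[-2] / c).
have [b bE] := theta_onto (- p _[-3] / c - a * a ^+ theta m).
have [d dE] := theta_onto (a ^+ theta m * b ^+ theta m - p _[0] / c).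
pose x := x_plus m a b d; have Ux : x \in U F m by apply/imsetP; exists (a, b, d).
exists x => //; have ree_h : (x^-1 * g)%g \in ree.
  by apply: mem_ree_mulV => //; apply: x_plus_ree.
have [pp0 pq0 [t flag]] := ree_flag ree_h.
set p' := val (x^-1 * g)%g *m u 1 in pp0 pq0 flag.
have xp' : p = val x *m p' by exact: val_mulVK.
have [_ r0 r3 r2 r1] := x_plus_rows cardF a b d p'; rewrite -/x -xp' in r0 r3 r2 r1.
have p2' : p' _[-2] = 0.
  by apply: (addIr (- (a ^+ theta m * p' _[-1]))); rewrite -r2 aE -r1 -/c add0r divfK // opprK.
have p3' : p' _[-3] = 0.
  apply: (addIr (- ((a * a ^+ theta m + b ^+ theta m) * p' _[-1]))).
  have := r3; rewrite p2' mulr0 addr0 => <-.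
  by rewrite bE -r1 -/c addrCA subrr addr0 add0r divfK // opprK.
have p0' : p' _[0] = 0.
  apply: (addIr ((a ^+ theta m * b ^+ theta m - d ^+ theta m) * p' _[-1])).
  have := r0; rewrite p2' p3' !mulr0 addr0 subr0 => <-.
  by rewrite dE -r1 -/c opprB addrCA subrr addr0 add0r divfK.
have p1'0 : p' _[-1] != 0 by rewrite -r1.
have [p1 p2 p3] := flag_opposite three0 pp0 flag p1'0 p2' p3' p0'.
have p'E : p' = c *: u (-1).
  by apply: cv7P; rewrite [RHS]mxE unit_cvE /= ?mulr1 ?mulr0.
rewrite /scales val_mul -mulmxA -/p' p'E -scalemxAr.
by rewrite [val (w F)]/(w_mx F) w_unit scalerN scaleNr.
Qed.

Let x_plus_row1 a b d p := let: And5 r _ _ _ _ := x_plus_rows cardF a b d p in r.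

Lemma x_plus_fix a b d : val (x_plus m a b d) *m u 1 = u 1.
Proof.
apply/matrixP=> i j; rewrite ord1 unit_cv_mul (x_plusE cardF _ _ _ [::]) mxE entry_grid unit_cvE.
by case: i => [[|[|[|[|[|[|[|i]]]]]]] hi].
Qed.

(** The parameters of x are chosen in turn so that the entries (1,2), (1,3),
    (1,0) of x^-1 g vanish; each choice uses that the preceding column is already
    a unit vector. *)
Lemma mem_U g : g \in ree -> scales 1 g -> g \in U F m.
Proof.
rewrite /scales scale1r => ree_g g1.
pose q := val g *m u 2; pose r := val g *m u 3; pose z := val g *m u 0.
have [a aE] := theta_onto q _[1].
have [b bE] := theta_onto r _[1].
have [d dE] := theta_onto (a ^+ theta m * b ^+ theta m - z _[1]).
pose x := x_plus m a b d; have Ux : x \in U F m by apply/imsetP; exists (a, b, d).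
have ree_x : x \in ree by apply: x_plus_ree.
suff xg : (x^-1 * g)%g = 1%g by rewrite -(mulKVg x g) xg mulg1.
have ree_h : (x^-1 * g)%g \in ree by apply: mem_ree_mulV.
have M := ree_mxP ree_h; set h := val (x^-1 * g)%g in M.
have xh (p : 'cV[F]_7) : val g *m p = val x *m (h *m p) by exact: val_mulVK.
have h1 : h *m u 1 = u 1.
  by rewrite /h val_mul -mulmxA g1 -{1}(x_plus_fix a b d) val_invK.
have row1 k : (val g *m u k) _[1] = (val x *m (h *m u k)) _[1] by rewrite xh.
have Hq : h (pos 1) (pos 2) = 0.
  have := row1 2; rewrite -/q -aE (ree_col2 M h1) x_plus_row1.
  rewrite !mxE /= => E; apply: (lincomb (c := -1) E); ring.
have c2 : h *m u 2 = u 2 by rewrite (ree_col2 M h1) Hq scale0r add0r.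
have Hr : h (pos 1) (pos 3) = 0.
  have := row1 3; rewrite -/r -bE (ree_col3 M h1 c2) x_plus_row1.
  rewrite !mxE /= => E; apply: (lincomb (c := -1) E); ring.
have c3 : h *m u 3 = u 3 by rewrite (ree_col3 M h1 c2) Hr scale0r add0r.
have Hz : h (pos 1) (pos 0) = 0.
  have := row1 0; rewrite -/z (ree_col0 M h1 c2 c3) x_plus_row1.
  rewrite dE !mxE /= => E; apply: (lincomb (c := -1) E); ring.
by apply: val_inj; apply: (ree_unipotent M h1).
Qed.

(** As q is 3 modulo 4, the (q + 1)/4-th power c' of c is defined, and c'^4 is
    c^(q + 1) = c^2. *)
Lemma pm_square (c : F) : exists a, c = a * a \/ c = - (a * a).
Proof.
have div4 : (4 %| 3 ^ (2 * m + 1) + 1)%N.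
  by rewrite /dvdn expnD expnM -modnDml -modnMml -modnXm exp1n.
pose k := ((3 ^ (2 * m + 1) + 1) %/ 4)%N; exists (c ^+ k).
have : (c ^+ k * c ^+ k) ^+ 2 = c ^+ 2.
  by rewrite -exprD -exprM addnn -muln2 -mulnA /k divnK // exprD -cardF expf_card.
move/eqP; rewrite eqf_sqr => /orP[]/eqP ->; first by left.
by right; rewrite opprK.
Qed.

(** The exponent 6 theta - 3 inverts 2 theta + 1 modulo q - 1, since
    (6 theta - 3)(2 theta + 1) = 12 theta^2 - 3 = 4 (q - 1) + 1. *)
Lemma root_2theta1 (a : F) : a != 0 -> exists t, t ^+ theta m * t ^+ theta m * t = a.
Proof.
move=> a0; exists (a ^+ (6 * theta m - 3)); rewrite -expr_2theta1.
apply: (mulIf (expf_neq0 3 a0)); rewrite -exprM -exprD -exprS.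
have -> : ((6 * theta m - 3) * (2 * theta m + 1) + 3 = theta m * 3 ^ m.+1 * 4)%N.
  have : (0 < theta m)%N by rewrite expn_gt0.
  by rewrite expnS -/(theta m); case: (theta m) => // n _; nia.
have aK := thetaK cardF a; rewrite /frob in aK.
by rewrite 2!exprM aK.
Qed.

Lemma w_row (v : 'cV[F]_7) : (w_mx F *m v) _[-1] = - v _[1].
Proof.
rewrite mxE (bigD1 (pos 1)) //= big1 ?addr0 => [|k k1]; rewrite mxE ?mulN1r //.
rewrite [X in if X then _ else _](_ : _ = false) ?mul0r //.
by apply: contraNF k1; case: k => [[|[|[|[|[|[|[|k]]]]]]] hk].
Qed.

(** The corner of w y w is the entry (1,-1) of y, which is t^(4 theta + 2) for
    y = x_1(t) and - v^(2 theta) for y = x_3(v). *)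
Lemma corner_onto c : c != 0 -> exists2 y, y \in U F m & corner (w F * y * w F)%g = c.
Proof.
have cornerE a b d : corner (w F * x_plus m a b d * w F)%g =
    (val (x_plus m a b d) *m u (-1)) _[1].
  rewrite /corner -unit_cv_mul !val_mul -!mulmxA.
  by rewrite [val (w F)]/(w_mx F) w_unit !mulmxN mxE w_row opprK.
have inU a b d : x_plus m a b d \in U F m by apply/imsetP; exists (a, b, d).
have theta0 : (0 : F) ^+ theta m = 0 by rewrite expr0n eqn0Ngt expn_gt0.
move=> c0; have [a cE] := pm_square c.
have a0 : a != 0 by apply: contraNneq c0 => a0; case: cE => ->; rewrite a0 mulr0 ?oppr0.
case: cE => cE.
- have [t tE] := root_2theta1 a0.
  exists (x_plus m t 0 0); rewrite ?cornerE //.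
  by rewrite x_plus_row1 !unit_cvE /= !theta0 cE -tE; ring.
have [v vE] := theta_onto a; exists (x_plus m 0 0 v); rewrite ?cornerE //.
by rewrite x_plus_row1 !unit_cvE /= !theta0 vE cE; ring.
Qed.

Lemma U_ree_scales x : x \in U F m -> x \in ree /\ scales 1 x.
Proof.
case/imsetP=> [[[a b] d] _ ->]; split; first exact: x_plus_ree.
by rewrite /scales scale1r x_plus_fix.
Qed.

Lemma U_mulV x y : x \in U F m -> y \in U F m -> (x^-1 * y)%g \in U F m.
Proof.
move=> /U_ree_scales[ree_x x1] /U_ree_scales[ree_y y1].
apply: mem_U; first exact: mem_ree_mulV.
by rewrite -[1]mulr1 -{1}invr1; apply: scalesM => //; apply: scalesV; rewrite ?oner_eq0.
Qed.

Theorem ree_factorization : small_ree sigma = (U F m * U_minus F m * U F m * U_minus F m)%g.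
Proof.
have UV x : x \in U F m -> x^-1%g \in U F m.
  by move=> Ux; rewrite -[x^-1%g]mulg1 -(mulVg x) U_mulV // U_mulV.
have sUG : U F m \subset ree by apply/subsetP=> x /U_ree_scales[].
have w_inv : (w F * w F = 1)%g by apply: val_inj; rewrite val_mul; apply: w_mxK.
have UM x y : x \in U F m -> y \in U F m -> (x * y)%g \in U F m.
  by move=> Ux Uy; rewrite -[x]invgK U_mulV // UV.
have ff := @four_factors _ (ree_grp Hsigma) (U F m) (w F) F corner scales sUG
  (w_ree cardF Hsigma) w_inv scalesM scalesV mem_U corner0 cornerN0 corner_onto UV UM.
exact: ff.
Qed.

End Ree.

Theorem lemma2 (m : nat) (F : finFieldType) (cardF : #|F| = (3 ^ (2 * m + 1))%N)
    (sigma : {perm {'GL_7[F]}}) (Hsigma : exceptional_automorphism m sigma) :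
  small_ree sigma = (U F m * U_minus F m * U F m * U_minus F m)%g.
Proof. exact: (ree_factorization cardF Hsigma). Qed.
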